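(* Let $n \geq 2$ be an integer and let $p$ be a real number with $1 < p < p_*$. Let $\lambda > 0$ and $\beta \geq 0$ be arbitrary real numbers. If $u \geq 0$ is a (classical) solution on $\mathbb{R}^n$ of $$\Delta u - \lambda\, x \cdot \nabla u + u^{p} - \beta u = 0, \qquad x \in \mathbb{R}^n,$$ then for every $\gamma > 0$, $$\int_{\mathbb{R}^n} \left( u^{p+1} e^{-\gamma |x|^2} + |\nabla u|^2 e^{-\gamma |x|^2} \right) dx < \infty.$$
   Context: The exponent $p_*$ is defined by $p_* = \infty$ if $1 \leq n \leq 2$, and $p_* = \frac{n+2}{n-2}$ if $n \geq 3$. *)

(* Defs.v *)
From HB Require Import structures.
From mathcomp Require Import all_boot all_order all_algebra.
From mathcomp Require Import all_classical all_reals all_analysis.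

Set Implicit Arguments.
Unset Strict Implicit.
Unset Printing Implicit Defensive.
Import Order.TTheory GRing.Theory Num.Theory.
Import numFieldNormedType.Exports.

Local Open Scope classical_set_scope.
Local Open Scope ring_scope.

(* The library norm on 'rV[R]_n is the max norm: it induces the usual topology,
   but the Euclidean |x|^2 has to be written dot x x. *)
Definition dot {R : realType} {n : nat} (x y : 'rV[R]_n) : R :=
  \sum_(i < n) x 0 i * y 0 i.

Section derivatives.
Context {R : realType} {n : nat}.
Implicit Types (u : 'rV[R]_n -> R) (x : 'rV[R]_n).

Definition partial (i : 'I_n) u : 'rV[R]_n -> R :=
  fun x => 'D_(delta_mx 0 i) u x.

Definition grad u x : 'rV[R]_n := \row_(i < n) partial i u x.

Definition laplacian u x : R := \sum_(i < n) partial i (partial i u) x.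

(* 'D_v f x is total (a junk value where f is not derivable), hence the
   explicit derivability clause. *)
Fixpoint is_C (k : nat) u : Prop :=
  continuous u /\
  (if k is k'.+1 then
     forall i : 'I_n,
       (forall x, derivable u x (delta_mx 0 i)) /\ is_C k' (partial i u)
   else True).

End derivatives.

Definition pair_cons {R : realType} {n : nat}
    (z : measurableTypeR R * n.-tuple (measurableTypeR R)) :
  n.+1.-tuple (measurableTypeR R) := [tuple of z.1 :: z.2].

Definition lebesgue_cons {R : realType} {n : nat}
    (mu : set (n.-tuple (measurableTypeR R)) -> \bar R) :
  set (n.+1.-tuple (measurableTypeR R)) -> \bar R :=
  pushforward (@lebesgue_measure R \x mu)%E pair_cons.

(* Lebesgue measure on R^n, for the product sigma-algebra on n-tuples of reals;
   its values on boxes are given by lebesgue_tuple_box. *)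
Fixpoint lebesgue_tuple {R : realType} (n : nat) :
    set (n.-tuple (measurableTypeR R)) -> \bar R :=
  if n is m.+1 then lebesgue_cons (lebesgue_tuple (n := m)) else \d_([tuple]).

Section lebesgue_cons_measure.
Context {R : realType} {n : nat}.
Variable mu :
  {sigma_finite_measure set (n.-tuple (measurableTypeR R)) -> \bar R}.

Local Notation pair_cons := (@pair_cons R n).
Local Notation nu := (lebesgue_cons mu).

Let measurable_pair_cons : measurable_fun setT pair_cons.
Proof. exact: measurable_cons. Qed.

Let uncons (t : n.+1.-tuple (measurableTypeR R)) :
  measurableTypeR R * n.-tuple (measurableTypeR R) :=
  (thead t, [tuple of behead t]).

Let measurable_uncons : measurable_fun setT uncons.
Proof.
by apply/measurable_fun_pair; [exact: measurable_tnth|exact: measurable_behead].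
Qed.

Let pair_consK : cancel pair_cons uncons.
Proof. by case=> x t; congr pair; apply/val_inj. Qed.

Let nu0 : nu set0 = 0%E. Proof. exact: measure0. Qed.

Let nu_ge0 A : (0 <= nu A)%E. Proof. exact: measure_ge0. Qed.

Let nu_sigma_additive : semi_sigma_additive nu.
Proof. exact: measure_semi_sigma_additive. Qed.

HB.instance Definition _ :=
  isMeasure.Build _ _ _ nu nu0 nu_ge0 nu_sigma_additive.

Let nu_sigma_finite : sigma_finite setT nu.
Proof.
have /sigma_finiteP[F [FT ndF Foo]] := sigma_finiteT (@lebesgue_measure R).
have /sigma_finiteP[G [GT ndG Goo]] := sigma_finiteT mu.
exists (fun k => uncons @^-1` (F k `*` G k)).
  apply/esym; rewrite -subTset => t _.
  have [i _ Fi] : (\bigcup_k F k) (uncons t).1 by rewrite -FT.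
  have [j _ Gj] : (\bigcup_k G k) (uncons t).2 by rewrite -GT.
  exists (maxn i j) => //; split.
    by move: Fi; exact/subsetPset/ndF/leq_maxl.
  by move: Gj; exact/subsetPset/ndG/leq_maxr.
move=> k; have [mF Fk] := Foo k; have [mG Gk] := Goo k; split.
  rewrite -[X in measurable X]setTI; apply: measurable_uncons => //.
  exact: measurableX.
rewrite /lebesgue_cons /pushforward -comp_preimage (_ : _ \o _ = id); last exact/funext.
by rewrite preimage_id product_measure1E// lte_mul_pinfty// ge0_fin_numE.
Qed.

HB.instance Definition _ :=
  Measure_isSigmaFinite.Build _ _ _ nu nu_sigma_finite.

End lebesgue_cons_measure.

Section lebesgue_tuple_measure.
Context {R : realType}.

Let lebesgue_tuple_ex n :
  exists m :
    {sigma_finite_measure set (n.-tuple (measurableTypeR R)) -> \bar R},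
    m = @lebesgue_tuple R n :> (set _ -> \bar R).
Proof.
elim: n => [|n [mu IH]] /=; first by exists (\d_([tuple])).
by rewrite -IH; exists (lebesgue_cons mu).
Qed.

Variable n : nat.
Local Notation lebn := (@lebesgue_tuple R n).

Let lebn0 : lebn set0 = 0%E.
Proof. by have [m <-] := lebesgue_tuple_ex n; exact: measure0. Qed.

Let lebn_ge0 A : (0 <= lebn A)%E.
Proof. by have [m <-] := lebesgue_tuple_ex n; exact: measure_ge0. Qed.

Let lebn_sigma_additive : semi_sigma_additive lebn.
Proof.
by have [m <-] := lebesgue_tuple_ex n; exact: measure_semi_sigma_additive.
Qed.

HB.instance Definition _ :=
  isMeasure.Build _ _ _ lebn lebn0 lebn_ge0 lebn_sigma_additive.

Let lebn_sigma_finite : sigma_finite setT lebn.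
Proof. by have [m <-] := lebesgue_tuple_ex n; exact: sigma_finiteT. Qed.

HB.instance Definition _ :=
  Measure_isSigmaFinite.Build _ _ _ lebn lebn_sigma_finite.

End lebesgue_tuple_measure.

Lemma lebesgue_tuple_box (R : realType) (n : nat)
    (A : 'I_n -> set (measurableTypeR R)) : (forall i, measurable (A i)) ->
  lebesgue_tuple [set t | forall i, A i (tnth t i)] =
  (\prod_(i < n) lebesgue_measure (A i))%E.
Proof.
elim: n A => [|n IH] A mA /=.
  rewrite big_ord0 diracE mem_set//; first by case.
rewrite big_ord_recl -IH; last by move=> i; exact: mA.
rewrite -product_measure1E//; last first.
  rewrite (_ : [set t | _] =
    \bigcap_(i in setT) ((fun t => tnth t i) @^-1` A (lift ord0 i)));
    last first.
    by apply/seteqP; split => t /= At i *; exact: At.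
  apply: fin_bigcap_measurable => // i _.
  by rewrite -[X in measurable X]setTI; exact: measurable_tnth.
congr product_measure1; apply/seteqP; split => -[x t] /=.
  move=> At; split; first exact: (At ord0).
  by move=> i; have := At (lift ord0 i); rewrite tnthS.
case=> Ax At i; case: (unliftP ord0 i) => [j ->|->//].
by rewrite tnthS; exact: At.
Qed.

Definition rV_of_tuple {R : realType} {n : nat}
    (t : n.-tuple (measurableTypeR R)) : 'rV[R]_n :=
  \row_(i < n) (tnth t i : R).

Definition integral_Rn {R : realType} {n : nat} (f : 'rV[R]_n -> R) : \bar R :=
  (\int[@lebesgue_tuple R n]_t (f (rV_of_tuple t))%:E)%E.

Definition p_star (R : realType) (n : nat) : \bar R :=
  if (n <= 2)%N then +oo%E else ((n%:R + 2) / (n%:R - 2))%:E.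

Definition classical_solution {R : realType} {n : nat} (lambda beta p : R)
    (u : 'rV[R]_n -> R) : Prop :=
  is_C 2 u /\
  forall x,
    laplacian u x - lambda * dot x (grad u x) + u x `^ p - beta * u x = 0.

(* Main.v *)
Require Import Defs.
From HB Require Import structures.
From mathcomp Require Import all_boot all_order all_algebra.
From mathcomp Require Import all_classical all_reals all_analysis.
From mathcomp Require Import measurable_realfun ring lra.

(** The claim follows from a local bound with polynomial growth: for v = u + 1,
    the integral over the ball of radius r of v^(p+1) + |grad u|^2 is at most
    C r^N for r >= 1 ([local_estimate]).  Such a bound makes every Gaussian
    weighted integral finite, because the Gaussian beats the dyadic growth of
    the balls ([gaussian_integrable]).

    The local bound is an integral estimate of Gidas and Spruck.  Put
    s = (p - 1) / 2 and z = v^s, so that the equation reads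
    Delta v = - v z^2 + lambda x . grad v + (terms of order below v^p).
    With weight v^(-s) and a cutoff function phi, four quantities of integral 0
    are combined ([null_integral_gs]): the null Lagrangian
    div W Delta v - tr (DW D^2 v) for the field W = phi v^(-s) grad v, and the
    divergences of phi v^(-s-1) |grad v|^2 grad v, of v^(-s) |grad v|^2 grad phi
    and of phi v^(1+s) grad v.  Their coefficients are such that the second
    derivatives of v occur, besides Delta v, only through the square norm of
    D^2 v + (a / v) grad v (x) grad v, which is at least its trace squared over
    n ([sqr_trace_le]).  In the variables y = |grad v| / v and z, and up to the
    factor v^2 / z, the combination is then at most - c phi (y^4 + z^4) plus
    errors that have degree at most 3 in (y, z) or are small multiples of the
    quartic terms ([gs_combination_le], [scaled_combination_le]).  A parameter a
    with c > 0 exists because p < (n + 2) / (n - 2): the polynomial in p that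
    decides it factors as (n + 2 - (n - 2) p) ((17 n - 2) p - (n + 2))
    ([gs_constants]).

    The cutoff is phi = eta^m with eta = max(0, 1 - |x|^2 / r^2); two
    derivatives of phi cost eta^(m-2), and an error r^2 eta^(m-2) T^3 with
    T = y + z is absorbed by eta^m T^4 unless T <= C r^2 / eta^2, in which case
    all powers of v and T are bounded by powers of r, provided m is large
    ([absorb_cubic_term]).  Integrating the pointwise inequality gives the
    local bound.

    The usual integration by parts of the null Lagrangian takes third
    derivatives of v, while u is only C^2.  With difference quotients in place
    of one derivative, translation invariance of Lebesgue measure and one
    integration by parts of C^1 functions suffice ([intR_null_lagrangian]). *)

Import Order.TTheory GRing.Theory Num.Theory.
Import numFieldNormedType.Exports.

Set Implicit Arguments.
Unset Strict Implicit.
Unset Printing Implicit Defensive.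

Local Open Scope classical_set_scope.
Local Open Scope ring_scope.

(** * Lebesgue measure on tuples: translations and continuous functions *)

Lemma integral_shift {R : realType} (a : R) (G : measurableTypeR R -> \bar R) :
  measurable_fun setT G -> (forall x, (0 <= G x)%E) ->
  (\int[@lebesgue_measure R]_x G (x + a)%R = \int[@lebesgue_measure R]_x G x)%E.
Proof.
move=> mG G0.
pose f (x : measurableTypeR R) : measurableTypeR R := x + a.
have mf : measurable_fun setT f by apply: measurable_funD.
pose phi : {mfun measurableTypeR R >-> measurableTypeR R} :=
  HB.pack f (isMeasurableFun.Build _ _ _ _ _ mf).
transitivity (\int[pushforward (@lebesgue_measure R) phi]_x G x)%E.
  by rewrite ge0_integral_pushforward ?preimage_setT.
apply: eq_measure_integral => A mA _; apply/esym.
apply: lebesgue_measure_unique => // X [[x y] _ <-] /=; rewrite /pushforward.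
rewrite (_ : _ @^-1` _ = `]x - a, y - a]%classic); last first.
  by apply/seteqP; split => z /=; rewrite !in_itv/= ltrBlDr lerBrDr.
rewrite !lebesgue_measure_itv /= !lte_fin ltrD2r; case: ifP => // _.
by rewrite -!EFinD opprB addrA subrK.
Qed.

Definition shift_tuple {R : realType} {n} (a : 'I_n -> R)
   (t : n.-tuple (measurableTypeR R)) : n.-tuple (measurableTypeR R) :=
  [tuple (tnth t i + a i : measurableTypeR R) | i < n].

Lemma measurable_shift_tuple {R : realType} {n} (a : 'I_n -> R) :
  measurable_fun setT (shift_tuple a).
Proof.
apply/measurable_fun_tnthP => i; rewrite /comp.
under eq_fun do rewrite tnth_mktuple.
apply: measurable_funD => //; exact: measurable_tnth.
Qed.

(** Translation invariance is the only property of the measure on which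
    integration by parts rests below; it passes from R to tuples by Tonelli. *)
Lemma integral_shift_tuple {R : realType} {n} (a : 'I_n -> R)
    (f : n.-tuple (measurableTypeR R) -> \bar R) :
  measurable_fun setT f -> (forall t, (0 <= f t)%E) ->
  (\int[@lebesgue_tuple R n]_t f (shift_tuple a t) =
   \int[@lebesgue_tuple R n]_t f t)%E.
Proof.
elim: n a f => [|n IH] a f mf f0.
  by apply: eq_integral => t _; congr f; rewrite tuple0 [RHS]tuple0.
have mc : measurable_fun setT (@pair_cons R n) by exact: measurable_cons.
have E g : measurable_fun setT g -> (forall t, (0 <= g t)%E) ->
    (\int[@lebesgue_tuple R n.+1]_t g t =
     \int[@lebesgue_measure R]_x \int[@lebesgue_tuple R n]_t g (pair_cons (x, t)))%E.
  move=> mg g0; rewrite /= /lebesgue_cons ge0_integral_pushforward//.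
  rewrite preimage_setT.
  have mgc : measurable_fun setT (g \o @pair_cons R n) by exact: measurableT_comp.
  by rewrite (fubini_tonelli1 _ mgc) // => x; exact: g0.
rewrite !E//; last by apply: measurableT_comp => //; exact: measurable_shift_tuple.
pose G (x : measurableTypeR R) := (\int[@lebesgue_tuple R n]_t f (pair_cons (x, t)))%E.
have mfc : measurable_fun setT (f \o @pair_cons R n) by exact: measurableT_comp.
have mG : measurable_fun setT G by apply: (measurable_fun_fubini_tonelli_F _ mfc) => x; exact: f0.
transitivity (\int[@lebesgue_measure R]_x G (x + a ord0)%R)%E.
  apply: eq_integral => x _.
  rewrite /G -(IH (fun i => a (lift ord0 i)) (fun t => f (pair_cons ((x + a ord0)%R, t)))) //; last first.
    apply: (measurableT_comp mf); apply: (measurableT_comp mc).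
    exact: pair1_measurable.
  apply: eq_integral => t _; congr f; apply: eq_from_tnth => i.
  rewrite tnth_mktuple /pair_cons.
  case: (unliftP ord0 i) => [j ->|->]; rewrite ?tnthS ?tnth0//.
  by rewrite tnth_mktuple.
apply: integral_shift => // x; exact: integral_ge0.
Qed.

(** A continuous function is the pointwise limit of its samples on the grids of
    mesh 1 / k, and a sampled function is constant on countably many boxes. *)
Lemma measurable_rV {R : realType} {n} (f : 'rV[R]_n -> R) : continuous f ->
  measurable_fun setT (fun t => f (rV_of_tuple t) : measurableTypeR R).
Proof.
move=> cf.
(* [q k t] is the grid point below [t]. *)
pose q (k : nat) (t : n.-tuple (measurableTypeR R)) : 'rV[R]_n :=
  \row_i ((Num.floor (k.+1%:R * tnth t i))%:~R / k.+1%:R).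
apply: (@measurable_fun_cvg _ _ _ _ (fun k t => f (q k t))); last first.
  move=> t _; apply: (@cvg_comp _ _ _ (fun k => q k t) f \oo (nbhs (rV_of_tuple t))); last exact: cf.
  apply/cvgrPdist_lt => e e0.
  have [N _ HN] : \forall k \near \oo, k.+1%:R^-1 < e by exact: near_infty_natSinv_lt (PosNum e0).
  exists N => // k Nk.
  rewrite /= [ltLHS]mx_normrE; apply: bigmax_lt => // -[i j] _ /=.
  rewrite !mxE; apply: le_lt_trans (HN _ Nk).
  set x := (tnth t j : R); have k0 : (0 : R) < k.+1%:R by [].
  have /andP[h1] := floor_itv (k.+1%:R * x); rewrite intrD => h2.
  have -> : x - (Num.floor (k.+1%:R * x))%:~R / k.+1%:R =
     (k.+1%:R * x - (Num.floor (k.+1%:R * x))%:~R) / k.+1%:R by rewrite mulrBl mulrAC divff ?mul1r.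
  rewrite normrM normfV (ger0_norm (ltW k0)) ger0_norm ?subr_ge0 //.
  by rewrite ler_pdivrMr // mulVf ?pnatr_eq0// lerBlDl ltW.
move=> k _ Y mY; rewrite setTI.
pose z2 (z : n.-tuple int) : 'rV[R]_n := \row_i ((tnth z i)%:~R / k.+1%:R).
rewrite (_ : _ @^-1` _ = \bigcup_(z in [set z : n.-tuple int | Y (f (z2 z))])
   [set t | forall i, tnth z i = Num.floor (k.+1%:R * tnth t i)]).
  rewrite bigcup_mkcond; apply: countable_bigcupT_measurable => [|z]; first exact: countableP.
  case: ifP => // _.
  rewrite (_ : [set t | _] =
    \bigcap_(i in setT) ((fun t => tnth t i) @^-1` [set x : measurableTypeR R | tnth z i = Num.floor (k.+1%:R * x)]));
    last first.
    by apply/seteqP; split => t /= At i *; exact: At.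
  apply: fin_bigcap_measurable => // i _.
  rewrite -[X in measurable X]setTI; apply: (measurable_tnth i) => //.
  rewrite (_ : [set x | _] = `[(tnth z i)%:~R / k.+1%:R, ((tnth z i) + 1)%:~R / k.+1%:R[%classic) //.
  apply/seteqP; split => x /=; rewrite in_itv/= ler_pdivrMr// ltr_pdivlMr// mulrC.
    by move=> ->; exact: floor_itv.
  by move=> h; apply/esym/floor_def.
apply/seteqP; split => t /=.
  move=> Yt; exists [tuple Num.floor (k.+1%:R * tnth t i) | i < n] => /=.
    by congr (Y (f _)): Yt; apply/rowP => i; rewrite !mxE tnth_mktuple.
  by move=> i; rewrite tnth_mktuple.
case=> z /= Yz zt; congr (Y (f _)): Yz; apply/rowP => i; rewrite !mxE zt//.
Qed.

(** * Integration of compactly supported continuous functions *)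

Section compactly_supported.
Context {R : realType} {n : nat}.
Implicit Types f g : 'rV[R]_n -> R.
Local Notation mu := (@lebesgue_tuple R n).

Definition intR f : R := \int[mu]_t f (rV_of_tuple t).

Definition vanishes_off (r : R) f := forall x, r < `|x| -> f x = 0.

(** No smoothness is built in: derivatives are separate hypotheses, one direction
    at a time. *)
Definition test_fun f := continuous f /\ exists r, vanishes_off r f.

Lemma coord_le_norm (x : 'rV[R]_n) i : `|x 0 i| <= `|x|.
Proof. by rewrite [leRHS]mx_normrE (le_bigmax _ (fun ij => `|x ij.1 ij.2|) (0, i)). Qed.

Lemma norm_le_coord (x : 'rV[R]_n) r : 0 <= r -> (forall i, `|x 0 i| <= r) -> `|x| <= r.
Proof.
move=> r0 xr; rewrite [leLHS]mx_normrE; apply: bigmax_le => // -[j i] _ /=.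
by rewrite ord1.
Qed.

Definition box (r : R) : set (n.-tuple (measurableTypeR R)) :=
  [set t | forall i, `[- r, r]%classic (tnth t i : R)].

Lemma boxP r t : 0 <= r -> box r t <-> `|@rV_of_tuple R n t| <= r.
Proof.
move=> r0; split=> [rt|tr i].
  apply: norm_le_coord => // i; rewrite mxE ler_norml.
  by have := rt i; rewrite /= in_itv.
by rewrite /= in_itv/= -ler_norml; apply: le_trans tr; have := coord_le_norm (rV_of_tuple t) i; rewrite mxE.
Qed.

Lemma measurable_box r : measurable (box r).
Proof.
rewrite (_ : box r = \bigcap_(i in setT) ((fun t => tnth t i) @^-1` (`[-r, r]%classic : set (measurableTypeR R)))); last first.
  by apply/seteqP; split => t /= At i *; exact: At.
apply: fin_bigcap_measurable => // i _.
by rewrite -[X in measurable X]setTI; apply: (measurable_tnth i).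
Qed.

Lemma measure_box r : 0 <= r -> (mu (box r) = ((2 * r) ^+ n)%:E)%E.
Proof.
move=> r0; rewrite /box (@lebesgue_tuple_box R n (fun=> `[-r, r]%classic)) //.
rewrite (eq_bigr (fun=> (2 * r)%:E)); last first.
  move=> i _; rewrite lebesgue_measure_itv /= lte_fin.
  case: ltP => [_|h]; first by rewrite -EFinD opprK mulr2n mulrDl mul1r.
  have -> : r = 0 by lra.
  by rewrite mulr0.
by rewrite prodEFin prodr_const card_ord.
Qed.

Definition bounded_support (r M : R) f := forall x, (`|f x| <= M) /\ (r < `|x| -> f x = 0).

Lemma integrable_box r M : 0 <= r -> mu.-integrable setT (fun t => (M * \1_(box r) t)%:E).
Proof.
move=> r0; under eq_fun do rewrite EFinM.
apply: (@integrableZl _ _ _ mu) => //.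
apply/integrableP; split; first by apply/measurable_EFinP; apply: measurable_indic; exact: measurable_box.
under eq_integral do rewrite gee0_abs ?lee_fin//.
have h : (mu (box r) < +oo)%E by rewrite measure_box// ltry.
by rewrite integral_indic//; [rewrite setIT; exact: h|exact: measurable_box].
Qed.

Lemma le_box_indic r M f t : 0 <= r -> bounded_support r M f ->
  `|f (rV_of_tuple t)| <= M * \1_(box r) t.
Proof.
move=> r0 fM; have [fM1 fM2] := fM (rV_of_tuple t).
rewrite indicE; case: (boolP (t \in box r)) => /= [_|]; first by rewrite mulr1.
rewrite notin_setE => tr; rewrite mulr0 fM2 ?normr0 // ltNge; apply/negP => h.
by apply: tr; apply/boxP.
Qed.

Lemma integrable_bounded_support r M f : 0 <= r ->
  measurable_fun setT (fun t => f (rV_of_tuple t) : measurableTypeR R) ->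
  bounded_support r M f ->
  mu.-integrable setT (fun t => (f (rV_of_tuple t))%:E).
Proof.
move=> r0 mf fM; apply: (@le_integrable _ _ _ mu _ _ _ _ _ _ (integrable_box M r0)) => //.
  exact/measurable_EFinP.
move=> t _; rewrite /= lee_fin [leRHS]ger0_norm; first exact: le_box_indic.
exact: le_trans (normr_ge0 _) (le_box_indic t r0 fM).
Qed.

Lemma continuous_bounded_ball f r : continuous f ->
  exists M, 0 <= M /\ forall x, `|x| <= r -> `|f x| <= M.
Proof.
move=> cf; have [r0|r0] := leP 0 r; last first.
  by exists 0; split => // x /le_lt_trans/(_ r0); rewrite ltNge normr_ge0.
have cA : compact [set x : 'rV[R]_n | `|x| <= r].
  apply: bounded_closed_compact.
    by exists r; split; [exact: num_real|move=> M rM x /= xr; exact/ltW/(le_lt_trans xr)].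
  apply: (@closed_comp _ _ (fun x : 'rV[R]_n => `|x|) [set y | y <= r]).
    by move=> x _; exact: norm_continuous.
  exact: closed_le.
have cn : continuous (fun x => `|f x|).
  by move=> x; apply: (cvg_comp _ _ (cf x)); exact: norm_continuous.
have [|c _ Hc] := EVT_max_rV _ cA (continuous_subspaceT cn).
  by exists 0; rewrite /= normr0.
by exists `|f c|; split => // x xr; apply: Hc; rewrite inE.
Qed.

Lemma test_fun_bounded f : test_fun f -> exists r M, 0 <= r /\ bounded_support r M f.
Proof.
move=> [cf [r fr]]; have [M [M0 HM]] := continuous_bounded_ball (Num.max r 0) cf.
exists (Num.max r 0), M; rewrite le_max lexx orbT; split => // x; split.
  have [/HM//|] := leP `|x| (Num.max r 0).
  by rewrite gt_max => /andP[/fr ->]; rewrite normr0.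
by rewrite gt_max => /andP[/fr ->].
Qed.

Lemma test_fun_integrable f : test_fun f ->
  mu.-integrable setT (EFin \o (fun t => (f (rV_of_tuple t)))).
Proof.
move=> cf; have [r [M [r0 fM]]] := test_fun_bounded cf.
by apply: integrable_bounded_support fM => //; apply: measurable_rV; case: cf.
Qed.

Lemma intR_shift f (a : 'rV[R]_n) : continuous f ->
  intR (fun x => f (x + a)) = intR f.
Proof.
move=> cf; rewrite /intR /Rintegral; congr fine.
pose av i : R := a 0 i.
pose F t := (f (rV_of_tuple t))%:E.
have mF : measurable_fun setT F by apply/measurable_EFinP; exact: measurable_rV.
transitivity (\int[mu]_t F (shift_tuple av t))%E.
  apply: eq_integral => t _; rewrite /F; do 2! congr (_ _).
  by apply/rowP => i; rewrite !mxE tnth_mktuple.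
rewrite [LHS]integralE [RHS]integralE.
congr (_ - _)%E.
  transitivity (\int[mu]_t F^\+ (shift_tuple av t))%E; first by apply: eq_integral => t _; rewrite !funeposE.
  by rewrite (integral_shift_tuple av (f := F^\+%E)) //; exact: measurable_funepos.
transitivity (\int[mu]_t F^\- (shift_tuple av t))%E; first by apply: eq_integral => t _; rewrite !funenegE.
by rewrite (integral_shift_tuple av (f := F^\-%E)) //; exact: measurable_funeneg.
Qed.

Lemma test_funD f g : test_fun f -> test_fun g -> test_fun (fun x => f x + g x).
Proof.
move=> [cf [r fr]] [cg [s gs]]; split; first by move=> x; exact: (cvgD (cf x) (cg x)).
exists (Num.max r s) => x; rewrite gt_max => /andP[rx sx].
by rewrite fr// gs// addr0.
Qed.

Lemma test_funM f g : test_fun f -> continuous g -> test_fun (fun x => f x * g x).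
Proof.
move=> [cf [r fr]] cg; split; first by move=> x; exact: (cvgM (cf x) (cg x)).
by exists r => x rx; rewrite fr// mul0r.
Qed.

Lemma test_funZ f c : test_fun f -> test_fun (fun x => c * f x).
Proof.
move=> cf; rewrite (_ : (fun x => c * _) = (fun x => f x * c)).
  by apply: test_funM => //; exact: cst_continuous.
by apply/funext => x; rewrite mulrC.
Qed.

Lemma intRD f g : test_fun f -> test_fun g -> intR (fun x => f x + g x) = intR f + intR g.
Proof. by move=> /test_fun_integrable cf /test_fun_integrable cg; rewrite /intR RintegralD. Qed.

Lemma intRZ f c : test_fun f -> intR (fun x => c * f x) = c * intR f.
Proof. by move=> /test_fun_integrable cf; rewrite /intR RintegralZl. Qed.

Lemma test_fun_shift f (a : 'rV[R]_n) : test_fun f -> test_fun (fun x => f (x + a)).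
Proof.
move=> [cf [r fr]]; split.
  move=> x; apply: (@cvg_comp _ _ _ (fun x => x + a) f (nbhs x) (nbhs (x + a))); last exact: cf.
  exact: (cvgD cvg_id (cvg_cst a)).
exists (r + `|a|) => x; rewrite -ltrBrDr => h; apply: fr; apply: lt_le_trans h _.
by rewrite lerBlDr; apply: le_trans (ler_normB _ _); rewrite addrK.
Qed.

(** Dominated convergence; the common bound and support are all that the
    difference quotients of a C^1 function provide. *)
Lemma intR_cvg (f_ : nat -> 'rV[R]_n -> R) f r M : 0 <= r ->
  (forall k, continuous (f_ k)) -> continuous f ->
  (forall k, bounded_support r M (f_ k)) ->
  (forall x, f_ k x @[k --> \oo] --> f x) ->
  intR (f_ k) @[k --> \oo] --> intR f.
Proof.
move=> r0 cf_ cf bf cvf.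
have H : [/\ mu.-integrable setT (fun t => (f (rV_of_tuple t))%:E),
    [sequence (\int[mu]_t (fun k t => `|(f_ k (rV_of_tuple t))%:E - (f (rV_of_tuple t))%:E|) k t)%E]_k @ \oo --> 0%E &
    [sequence (\int[mu]_t (f_ k (rV_of_tuple t))%:E)%E]_k @ \oo --> (\int[mu]_t (f (rV_of_tuple t))%:E)%E].
  apply: (@dominated_convergence _ _ _ mu setT measurableT (fun k t => (f_ k (rV_of_tuple t))%:E) (fun t => (f (rV_of_tuple t))%:E) (fun t => (M * \1_(box r) t)%:E)) => //.
  - by move=> k; apply/measurable_EFinP; exact: measurable_rV.
  - by apply/measurable_EFinP; exact: measurable_rV.
  - by apply: aeW => t _; apply/cvg_EFin; [exact: nearW|exact: cvf].
  - exact: integrable_box.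
  - by apply: aeW => t k _ /=; rewrite lee_fin le_box_indic.
case: H => intf _.
have -> : (\int[mu]_t (f (rV_of_tuple t))%:E)%E = (intR f)%:E.
  by rewrite /intR /Rintegral fineK//; exact: integrable_fin_num.
by move/fine_cvgP => [_].
Qed.

End compactly_supported.

(** * Difference quotients and integration by parts *)

Section difference_quotients.
Context {R : realType} {n : nat}.
Implicit Types f g F G P df dg dF dP Fi Fj gi gj : 'rV[R]_n -> R.
Local Notation e i := (delta_mx 0 i : 'rV[R]_n).

Lemma is_derive_line f (x v : 'rV[R]_n) (t d : R) :
  is_derive (x + t *: v) v f d -> is_derive t 1 (fun s => f (x + s *: v)) d.
Proof.
move=> [df <-].
have E : (fun h => h^-1 *: (((fun s => f (x + s *: v)) \o shift t) (h *: 1) - f (x + t *: v))) =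
   (fun h => h^-1 *: ((f \o shift (x + t *: v)) (h *: v) - f (x + t *: v))).
  apply/funext => h /=; do 3! congr (_ _).
  by rewrite scalerDl [h *: 1]mulr1 addrCA.
by apply: DeriveDef; rewrite /derivable /derive E.
Qed.

Definition diff_quot i (h : R) f x : R := h^-1 * (f (x + h *: e i) - f x).

(** The mean value theorem along a coordinate line. *)
Lemma diff_quot_mean i f df (x : 'rV[R]_n) h :
  (forall x, is_derive x (e i) f (df x)) -> h != 0 ->
  exists2 c, `|c| <= `|h| & diff_quot i h f x = df (x + c *: e i).
Proof.
move=> fdf h0; rewrite /diff_quot.
have D (t : R) : is_derive t (1 : R) (fun s : R => f (x + s *: e i)) (df (x + t *: e i)).
  exact: is_derive_line.
have C : continuous (fun s : R => f (x + s *: e i)).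
  by move=> t; apply/differentiable_continuous/derivable1_diffP; exact: (@ex_derive _ _ _ _ _ _ _ (D t)).
have [h_gt0|h_lt0|h00] := ltgtP 0 h; last by rewrite -h00 eqxx in h0.
- have [c + H] := MVT_segment (ltW h_gt0) (fun t _ => D t) (continuous_subspaceT C).
  rewrite in_itv /= => /andP[c0 ch]; exists c; first by rewrite !ger0_norm // ltW.
  move: H; rewrite scale0r addr0 => ->.
  by rewrite subr0 mulrC mulfK.
- have [c + H] := MVT_segment (ltW h_lt0) (fun t _ => D t) (continuous_subspaceT C).
  rewrite in_itv /= => /andP[c0 ch]; exists c; first by rewrite !ler0_norm ?lerN2 // ltW.
  move: H; rewrite scale0r addr0 => H.
  by rewrite -[f _ - f x]opprB H sub0r [df _ * _]mulrN opprK mulrCA mulVf ?mulr1.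
Qed.

Lemma diff_quot_bound i f df (x : 'rV[R]_n) h M :
  (forall x, is_derive x (e i) f (df x)) ->
  (forall c, `|c| <= `|h| -> `|df (x + c *: e i)| <= M) -> h != 0 ->
  `|diff_quot i h f x| <= M.
Proof. by move=> D dfM h0; have [c ch ->] := diff_quot_mean x D h0; exact: dfM. Qed.

Lemma diff_quot_cvg i f x d (h : nat -> R) : is_derive x (e i) f d ->
  (forall k, h k != 0) -> h @ \oo --> 0 ->
  diff_quot i (h k) f x @[k --> \oo] --> d.
Proof.
move=> [df <-] h0 hc; rewrite /derive.
have hc' : h @ \oo --> 0^'.
  move=> A /= /hc; rewrite /nbhs /=; apply: filterS => k; apply.
  exact: h0.
have := @cvg_comp _ _ _ h _ \oo 0^' _ hc' df.
apply: cvg_trans; apply: near_eq_cvg; apply: nearW => k /=.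
by rewrite /diff_quot /= (addrC x).
Qed.

Lemma continuous_translate f (a : 'rV[R]_n) : continuous f ->
  continuous (fun x : 'rV[R]_n => f (x + a)).
Proof.
move=> cf x.
apply: (@cvg_comp _ _ _ (fun x : 'rV[R]_n => x + a) f (nbhs x) (nbhs (x + a))); last exact: cf.
exact: (cvgD cvg_id (cvg_cst _)).
Qed.

Lemma continuous_diff_quot i h f : continuous f -> continuous (diff_quot i h f).
Proof.
move=> cf x.
exact: (cvgM (cvg_cst h^-1) (cvgB (@continuous_translate f (h *: e i) cf x) (cf x))).
Qed.

Lemma norm_basis i : `|e i| <= 1.
Proof.
by apply: norm_le_coord => // j; rewrite mxE eqxx /=; case: eqP => _ //=; rewrite ?normr0 ?normr1 ?ler01.
Qed.

Lemma norm_add_basis i (x : 'rV[R]_n) c r : `|x| <= r -> `|c| <= 1 -> `|x + c *: e i| <= r + 1.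
Proof.
move=> xr c1; apply: le_trans (ler_normD _ _) _; apply: lerD => //.
rewrite normrZ -[leRHS]mulr1; apply: ler_pM => //; exact: norm_basis.
Qed.

Lemma norm_add_basis_gt i (x : 'rV[R]_n) c r : r + 1 < `|x| -> `|c| <= 1 -> r < `|x + c *: e i|.
Proof.
move=> xr c1; rewrite ltNge; apply/negP => h.
have := @norm_add_basis i (x + c *: e i) (- c) r h; rewrite normrN => /(_ c1).
by rewrite scaleNr addrK leNgt xr.
Qed.

(** The vanishing hypothesis bears on the product: either factor may be the one
    with compact support, and [intR_partial0] uses the constant [G] = 1. *)
Lemma intR_diff_quot_cvg i G f df (h : nat -> R) (r : R) :
  continuous G -> continuous f -> continuous df ->
  (forall x, is_derive x (e i) f (df x)) ->
  (forall k, h k != 0) -> (forall k, `|h k| <= 1) -> h @ \oo --> 0 -> 0 <= r ->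
  (forall k x, r < `|x| -> G x * diff_quot i (h k) f x = 0) ->
  intR (fun x => G x * diff_quot i (h k) f x) @[k --> \oo] --> intR (fun x => G x * df x).
Proof.
move=> cG cf cdf fdf h0 h1 hc r0 Gr.
have [M [M0 HM]] := continuous_bounded_ball (r + 1) cdf.
have [M' [M'0 HM']] := continuous_bounded_ball r cG.
apply: (@intR_cvg _ _ _ _ r (M' * M)) => //.
- by move=> k x; apply: (cvgM (cG x)); exact: continuous_diff_quot.
- by move=> x; exact: (cvgM (cG x) (cdf x)).
- move=> k x; split; last exact: Gr.
  have [xr|xr] := leP `|x| r; last by rewrite Gr // normr0 mulr_ge0.
  rewrite normrM ler_pM //; first exact: HM'.
  apply: (diff_quot_bound fdf) => // c ck; apply: HM; apply: norm_add_basis => //.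
  exact: le_trans (h1 k).
- by move=> x; exact: (cvgM (cvg_cst (G x)) (diff_quot_cvg (fdf x) h0 hc)).
Qed.

Definition inv_succ (k : nat) : R := k.+1%:R^-1.

Lemma inv_succ_neq0 k : inv_succ k != 0. Proof. by rewrite invr_eq0 pnatr_eq0. Qed.

Lemma inv_succ_le1 k : `|inv_succ k| <= 1.
Proof. by rewrite ger0_norm ?invr_ge0 // invf_le1 // ler1n. Qed.

Lemma inv_succ_cvg : inv_succ @ \oo --> 0.
Proof. exact: cvg_harmonic. Qed.

Lemma diff_quot_vanish i h F r : `|h| <= 1 -> vanishes_off r F ->
  vanishes_off (r + 1) (diff_quot i h F).
Proof.
move=> h1 Fr x xr; rewrite /diff_quot !Fr ?subrr ?mulr0 //.
  by apply: lt_trans xr; rewrite ltrDl.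
exact: norm_add_basis_gt.
Qed.

Lemma test_fun_derive i F dF : test_fun F -> continuous dF ->
  (forall x, is_derive x (e i) F (dF x)) -> test_fun dF.
Proof.
move=> [cF [r Fr]] cdF D; split => //; exists (r + 1) => x xr.
apply: (@cvg_unique _ (@Rhausdorff R) _ _ _ _ (diff_quot_cvg (D x) inv_succ_neq0 inv_succ_cvg)).
rewrite (_ : (fun k => _) = cst 0); first exact: cvg_cst.
by apply/funext => k; exact: (@diff_quot_vanish i (inv_succ k) F r (inv_succ_le1 k) Fr x xr).
Qed.

(** The integral of a difference quotient is 0 by translation invariance. *)
Lemma intR_partial0 i F dF : test_fun F -> continuous dF ->
  (forall x, is_derive x (e i) F (dF x)) -> intR dF = 0.
Proof.
move=> ccF cdF D; have [cF [r Fr]] := ccF.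
have r0 : 0 <= Num.max r 0 + 1 by rewrite addr_ge0 // le_max lexx orbT.
have Z k : intR (fun x => 1 * diff_quot i (inv_succ k) F x) = 0.
  transitivity (intR (fun x => (inv_succ k)^-1 * (F (x + inv_succ k *: e i) + (-1) * F x))).
    by congr intR; apply/funext => x; rewrite mul1r mulN1r.
  rewrite intRZ; last by apply: test_funD; [exact: test_fun_shift|exact: test_funZ].
  rewrite intRD; [|exact: test_fun_shift|exact: test_funZ].
  by rewrite intR_shift // intRZ // mulN1r subrr mulr0.
have := @intR_diff_quot_cvg i (cst (1:R)) F dF inv_succ _ (@cst_continuous _ _ (1 : R)) cF cdF D inv_succ_neq0 inv_succ_le1 inv_succ_cvg r0.
rewrite (_ : (fun k => _) = cst 0); last by apply/funext => k; exact: Z.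
rewrite (_ : (fun x => _ * _) = dF); last by apply/funext => x; rewrite /= mul1r.
move=> H; apply: (@cvg_unique _ (@Rhausdorff R) _ _ _ _ (H _) (cvg_cst 0)).
move=> k x xr; rewrite (@diff_quot_vanish i (inv_succ k) F (Num.max r 0)) ?mulr0//; first exact: inv_succ_le1.
by move=> y; rewrite gt_max => /andP[/Fr].
Qed.

Lemma is_derive_mul (V : normedModType R) (f g : V -> R) (x v : V) (df dg : R) :
  is_derive x v f df -> is_derive x v g dg ->
  is_derive x v (fun y => f y * g y) (f x * dg + g x * df).
Proof. by move=> hf hg; exact: is_deriveM. Qed.

Lemma intR_by_parts i P dP g dg : test_fun P -> continuous dP ->
  continuous g -> continuous dg ->
  (forall x, is_derive x (e i) P (dP x)) -> (forall x, is_derive x (e i) g (dg x)) ->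
  intR (fun x => dP x * g x) = - intR (fun x => P x * dg x).
Proof.
move=> ccP cdP cg cdg DP Dg; apply/eqP; rewrite -addr_eq0 addrC; apply/eqP.
have cP := ccP.1.
rewrite -intRD; [|exact: test_funM|exact: test_funM (test_fun_derive ccP cdP DP) cg].
apply: (@intR_partial0 i (fun x => P x * g x)); first exact: test_funM.
  by move=> x; apply: (cvgD (cvgM (cP x) (cdg x)) (cvgM (cdP x) (cg x))).
by move=> x; rewrite [_ * g x]mulrC; exact: is_derive_mul.
Qed.

Lemma is_derive_shift_rV f (x v a : 'rV[R]_n) d :
  is_derive (x + a) v f d -> is_derive x v (fun y => f (y + a)) d.
Proof.
move=> [df <-].
have E : (fun h : R => h^-1 *: (((fun y => f (y + a)) \o shift x) (h *: v) - f (x + a))) =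
   (fun h => h^-1 *: ((f \o shift (x + a)) (h *: v) - f (x + a))).
  by apply/funext => h /=; rewrite addrA.
by apply: DeriveDef; rewrite /derivable /derive E.
Qed.

(** If [g] were C^2 this would be two integrations by parts.  For a C^1 function
    [g], replace its derivative along [j] by a difference quotient, move that
    quotient to [Fi] by translation, commute it with the derivative along [i],
    and integrate by parts once. *)
Lemma intR_null_lagrangian i j F Fi Fj g gi gj :
  test_fun F -> continuous Fi -> continuous Fj ->
  continuous g -> continuous gi -> continuous gj ->
  (forall x, is_derive x (e i) F (Fi x)) -> (forall x, is_derive x (e j) F (Fj x)) ->
  (forall x, is_derive x (e i) g (gi x)) -> (forall x, is_derive x (e j) g (gj x)) ->
  intR (fun x : 'rV[R]_n => Fi x * gj x) = intR (fun x => Fj x * gi x).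
Proof.
move=> ccF cFi cFj cg cgi cgj DFi DFj Dgi Dgj.
have ccFi := test_fun_derive ccF cFi DFi.
have [cF [r Fr]] := ccF.
have [r' Fir] := ccFi.2.
pose s := Num.max (Num.max r r' + 1) 0.
have s0 : 0 <= s by rewrite /s le_max lexx orbT.
have Nh0 k : - inv_succ k != 0 by rewrite oppr_eq0 inv_succ_neq0.
have Nh1 k : `|- inv_succ k| <= 1 by rewrite normrN inv_succ_le1.
have Nhc : (fun k => - inv_succ k) @ \oo --> 0 by rewrite -[X in _ --> X]oppr0; apply: cvgN; exact: inv_succ_cvg.
have L1 : intR (fun x : 'rV[R]_n => Fi x * diff_quot j (inv_succ k) g x) @[k --> \oo] --> intR (fun x : 'rV[R]_n => Fi x * gj x).
  apply: (intR_diff_quot_cvg (r := s)) => //; [exact: inv_succ_neq0|exact: inv_succ_le1|exact: inv_succ_cvg|].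
  move=> k x sx; rewrite Fir ?mul0r //; apply: le_lt_trans sx.
  by rewrite /s !le_max; apply/orP; left; rewrite -[leLHS]addr0 lerD // le_max lexx orbT.
have L2 : intR (fun x => gi x * diff_quot j (- inv_succ k) F x) @[k --> \oo] --> intR (fun x => gi x * Fj x).
  apply: (intR_diff_quot_cvg (r := s)) => //.
  move=> k x sx; rewrite (@diff_quot_vanish j (- inv_succ k) F r) ?mulr0 //; apply: le_lt_trans sx.
  by rewrite /s !le_max; apply/orP; left; rewrite lerD2r le_max lexx.
rewrite [RHS](_ : _ = intR (fun x => gi x * Fj x)); last first.
  by congr intR; apply/funext => x; rewrite mulrC.
suff E k : intR (fun x : 'rV[R]_n => Fi x * diff_quot j (inv_succ k) g x) = intR (fun x => gi x * diff_quot j (- inv_succ k) F x).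
  apply: (@cvg_unique _ (@Rhausdorff R) _ _ _ _ L1).
  by rewrite (_ : (fun k => _) = (fun k => intR (fun x => gi x * diff_quot j (- inv_succ k) F x))) //; exact/funext.
set h := inv_succ k; set c := h^-1.
pose A y := Fi (y - h *: e j).
have ccA : test_fun A by exact: test_fun_shift.
transitivity (intR (fun x => c * (A x * g x + (-1) * (Fi x * g x)))).
  have H1 : intR (fun x : 'rV[R]_n => Fi x * g (x + h *: e j)) = intR (fun x => A x * g x).
    rewrite -(@intR_shift _ _ (fun x => A x * g x) (h *: e j)).
      by congr intR; apply/funext => x; rewrite /A addrK.
    by move=> x; exact: (cvgM (ccA.1 x) (cg x)).
  have cgs := @continuous_translate g (h *: e j) cg.
  rewrite intRZ; last by apply: test_funD; [exact: test_funM|apply: test_funZ; exact: test_funM].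
  rewrite intRD; [|exact: test_funM|by apply: test_funZ; exact: test_funM].
  rewrite -H1 -intRD; [|exact: test_funM|by apply: test_funZ; exact: test_funM].
  rewrite -intRZ; last by apply: test_funD; [exact: test_funM|apply: test_funZ; exact: test_funM].
  by congr intR; apply/funext => x; rewrite /diff_quot -/c; ring.
have ccD' : test_fun (diff_quot j (- h) F).
  by split; [exact: continuous_diff_quot|exists (r + 1); apply: diff_quot_vanish => //; exact: Nh1].
have DP (x : 'rV[R]_n) : is_derive x (e i) (diff_quot j (- h) F) (diff_quot j (- h) Fi x).
  by apply: is_deriveZ; apply: is_deriveB; exact: is_derive_shift_rV.
have H := @intR_by_parts i _ _ g gi ccD' (continuous_diff_quot cFi) cg cgi DP Dgi.
rewrite [RHS](_ : _ = intR (fun x => diff_quot j (- h) F x * gi x)); last first.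
  by congr intR; apply/funext => x; rewrite mulrC.
apply: oppr_inj; rewrite -H.
rewrite -[LHS]mulN1r -intRZ; last first.
  by apply: test_funZ; apply: test_funD; [exact: test_funM|apply: test_funZ; exact: test_funM].
by congr intR; apply/funext => x; rewrite /diff_quot invrN -/c /A scaleNr; ring.
Qed.

End difference_quotients.

(** * Directional derivatives *)

Section calculus.
Context {R : realType} {n : nat}.
Implicit Types f g F G df dg : 'rV[R]_n -> R.
Local Notation e i := (delta_mx 0 i : 'rV[R]_n).

(** Both mixed derivatives are limits of the same second difference quotient,
    by two applications of the mean value theorem. *)
Lemma partial_sym i j f fi fj fij fji :
  (forall x, is_derive x (e i) f (fi x)) -> (forall x, is_derive x (e j) f (fj x)) ->
  (forall x, is_derive x (e j) fi (fij x)) -> (forall x, is_derive x (e i) fj (fji x)) ->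
  continuous fij -> continuous fji -> forall x, fij x = fji x.
Proof.
move=> Di Dj Dij Dji cij cji x.
have key k l g gk gkl : (forall x, is_derive x (e k) g (gk x)) ->
    (forall x, is_derive x (e l) gk (gkl x)) -> continuous gkl ->
    diff_quot k (@inv_succ R m) (diff_quot l (@inv_succ R m) g) x @[m --> \oo] --> gkl x.
  move=> Dk Dkl cgkl; apply/cvgrPdist_lt => ep ep0.
  have /cvgrPdist_lt/(_ _ ep0) := cgkl x.
  rewrite -[X in X -> _]/(nbhs x _) => /nbhs_normP[d /= d0 Hd].
  have [N _ HN] : \forall m \near \oo, (@inv_succ R m) < d / 2.
    have d20 : 0 < d / 2 by rewrite divr_gt0.
    exact: near_infty_natSinv_lt (PosNum d20).
  exists N => // m /HN md.
  have Dq y : is_derive y (e k) (diff_quot l (@inv_succ R m) g) (diff_quot l (@inv_succ R m) gk y).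
    by apply: is_deriveZ; apply: is_deriveB; exact: is_derive_shift_rV.
  have [c ch ->] := diff_quot_mean x Dq (inv_succ_neq0 m).
  have [c' ch' ->] := diff_quot_mean (x + c *: e k) Dkl (inv_succ_neq0 m).
  apply: Hd; rewrite /ball_ /= opprD addrA opprD addrA subrr sub0r -opprD normrN.
  have h0 : 0 <= @inv_succ R m by rewrite invr_ge0.
  rewrite (ger0_norm h0) in ch ch'.
  apply: le_lt_trans (ler_normD _ _) _; rewrite !normrZ.
  have H1 := norm_basis (R := R) k; have H2 := norm_basis (R := R) l.
  have H3 : `|c| * `|e k| <= @inv_succ R m by rewrite -[leRHS]mulr1 ler_pM.
  have H4 : `|c'| * `|e l| <= @inv_succ R m by rewrite -[leRHS]mulr1 ler_pM.
  by lra.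
have K1 := key i j f fi fij Di Dij cij.
have K2 := key j i f fj fji Dj Dji cji.
apply: (@cvg_unique _ (@Rhausdorff R) _ _ _ _ K1).
rewrite (_ : (fun m => _) = (fun m => diff_quot j (@inv_succ R m) (diff_quot i (@inv_succ R m) f) x)) //.
apply/funext => m; rewrite /diff_quot.
rewrite (addrAC x (@inv_succ R m *: e i)); ring.
Qed.

(** Converse of [is_derive_line] at the origin of the line; it reduces the chain
    rule to functions of one variable. *)
Lemma is_derive_of_line f (x v : 'rV[R]_n) (d : R) :
  is_derive 0 (1:R) (fun s : R => f (x + s *: v)) d -> is_derive x v f d.
Proof.
move=> [df <-].
have E : (fun h : R => h^-1 *: (((fun s : R => f (x + s *: v)) \o shift 0) (h *: (1:R)) - f (x + 0 *: v))) =
   (fun h : R => h^-1 *: ((f \o shift x) (h *: v) - f x)).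
  apply/funext => h /=; rewrite scale0r !addr0.
  by rewrite [h *: 1]mulr1 (addrC x).
have df' := df; rewrite /derivable E in df'.
by apply: DeriveDef => //; rewrite /derive E.
Qed.

Lemma is_derive_comp1 (g : R -> R) f (x v : 'rV[R]_n) (df dg : R) :
  is_derive x v f df -> is_derive (f x) (1:R) g dg ->
  is_derive x v (fun y => g (f y)) (dg * df).
Proof.
move=> Df Dg; apply: is_derive_of_line.
have Dl : is_derive 0 (1:R) (fun s : R => f (x + s *: v)) df.
  by apply: is_derive_line; rewrite scale0r addr0.
have Dg' : is_derive (f (x + (0:R) *: v)) (1:R) g dg by rewrite scale0r addr0.
by have := @is_derive1_comp _ g (fun s : R => f (x + s *: v)) 0 dg df Dg' Dl.
Qed.

Lemma is_derive_add (V : normedModType R) (f g : V -> R) (x v : V) (df dg : R) :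
  is_derive x v f df -> is_derive x v g dg ->
  is_derive x v (fun y => f y + g y) (df + dg).
Proof. by move=> hf hg; exact: is_deriveD. Qed.

Lemma is_derive_scale (V : normedModType R) (c : R) (f : V -> R) (x v : V) (df : R) :
  is_derive x v f df -> is_derive x v (fun y => c * f y) (c * df).
Proof. by move=> hf; exact: is_deriveZ. Qed.

Lemma is_derive_coord i j (x : 'rV[R]_n) :
  is_derive x (e i) (fun y => y 0 j : R) (i == j)%:R.
Proof.
apply: is_derive_of_line.
rewrite (_ : (fun s : R => _) = (fun s : R => x 0 j + s * (i == j)%:R)); last first.
  by apply/funext => s; rewrite !mxE eqxx /= eq_sym.
pose c : R := (i == j)%:R; rewrite -/c.
have H1 : is_derive (0 : R) (1 : R) (fun s : R => s * c) (0 * 0 + c * 1).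
  exact: (is_derive_mul (is_derive_id _ _) (is_derive_cst c _ _)).
have H2 := is_derive_add (is_derive_cst (x 0 j : R) (0 : R) (1 : R)) H1.
by apply: (is_derive_eq H2); rewrite mul0r !add0r mulr1.
Qed.

Lemma is_derive_bigsum (m : nat) (h dh : 'I_m -> 'rV[R]_n -> R) (x v : 'rV[R]_n) :
  (forall k, is_derive x v (h k) (dh k x)) ->
  is_derive x v (fun y => \sum_(k < m) h k y) (\sum_(k < m) dh k x).
Proof.
move=> D; rewrite (_ : (fun y => _) = \sum_(k < m) h k).
  exact: is_derive_sum.
by apply/funext => y; rewrite fct_sumE.
Qed.

Lemma is_derive_dot i (x : 'rV[R]_n) : is_derive x (e i) (fun y => dot y y) (2 * x 0 i).
Proof.
apply: (@is_derive_eq _ _ _ _ _ _ _ (\sum_(k < n) (x 0 k * (i == k)%:R + x 0 k * (i == k)%:R))).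
  apply: (@is_derive_bigsum n (fun k y => y 0 k * y 0 k) (fun k x => (x 0 k * (i == k)%:R + x 0 k * (i == k)%:R))) => k.
  by apply: is_derive_mul; exact: is_derive_coord.
rewrite (bigD1 i) //= eqxx big1 ?addr0 ?mulr1; first by rewrite mulr2n mulrDl mul1r.
by move=> k ki; rewrite eq_sym (negbTE ki) !mulr0 addr0.
Qed.

End calculus.

(** Powers of the positive part are stable under derivation, which is why the
    cutoff functions are built from them. *)
Lemma is_derive_relu (R : realType) (m : nat) (s : R) :
  is_derive s (1:R) (fun t => (Num.max 0 t) ^+ m.+2) (m.+2%:R * (Num.max 0 s) ^+ m.+1).
Proof.
have [s0|s0|<-] := ltgtP 0 s.
- have H : is_derive s (1:R) (fun t : R => t ^+ m.+2) (m.+2%:R * s ^+ m.+1).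
    by apply: (DeriveDef (@exprn_derivable R m.+2 s 1)); rewrite exp_derive [LHS]mulr1.
  have E : \near s, s ^+ m.+2 = (Num.max 0 s) ^+ m.+2.
    by near=> t; rewrite max_r //; apply: ltW; near: t; exact: lt_nbhsr.
  exact: (near_eq_is_derive E H).
- rewrite expr0n mulr0.
  have E : \near s, (0:R) = (Num.max 0 s) ^+ m.+2.
    by near=> t; rewrite max_l ?expr0n //; apply: ltW; near: t; exact: lt_nbhsl.
  exact: (near_eq_is_derive E (is_derive_cst (0:R) s (1:R))).
rewrite expr0n mulr0.
have E : (fun h : R => h^-1 *: (((fun t : R => (Num.max 0 t) ^+ m.+2) \o shift 0) (h *: (1:R)) - (Num.max 0 0) ^+ m.+2)) @ 0^' --> (0 : R).
  apply/cvgr0Pnorm_lt => ep ep0.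
  near=> h; rewrite /= maxxx expr0n subr0 addr0 [h *: 1]mulr1 normrZ normfV.
  have h0 : h != 0 by near: h; exact: nbhs_dnbhs_neq.
  have h1 : `|h| < Num.min ep 1 by near: h; apply: dnbhs0_lt; rewrite lt_min ep0 ltr01.
  rewrite ltr_pdivrMl ?normr_gt0 // exprS normrM.
  move: h1; rewrite lt_min => /andP[h1 h2].
  have H1 : `|Num.max 0 h| <= `|h| by rewrite ger0_norm ?le_max ?lexx // ge_max normr_ge0 ler_norm.
  apply: (@le_lt_trans _ _ (`|h| * `|h|)); last by rewrite ltr_pM2l ?normr_gt0.
  apply: ler_pM => //; apply: le_trans (H1).
  rewrite normrX exprS -[leRHS]mulr1 ler_pM ?exprn_ge0 // exprn_ile1 //.
  exact: le_trans H1 (ltW h2).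
have df : derivable (fun t : R => (Num.max 0 t) ^+ m.+2) 0 (1:R) by apply/cvg_ex; exists 0.
exact: (DeriveDef df (cvg_lim _ E)).
Unshelve. all: by end_near. Qed.

(** * The Gidas-Spruck combination of divergences *)

Section continuity.
Context {R : realType} {n : nat}.
Implicit Types f g : 'rV[R]_n -> R.

Lemma contD f g : continuous f -> continuous g -> continuous (fun x => f x + g x).
Proof. by move=> cf cg x; exact: (cvgD (cf x) (cg x)). Qed.

Lemma contM f g : continuous f -> continuous g -> continuous (fun x => f x * g x).
Proof. by move=> cf cg x; exact: (cvgM (cf x) (cg x)). Qed.

Lemma contN f : continuous f -> continuous (fun x => - f x).
Proof. by move=> cf x; exact: (cvgN (cf x)). Qed.

Lemma contC (c : R) : continuous (fun _ : 'rV[R]_n => c).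
Proof. exact: cst_continuous. Qed.

Lemma cont_sum (m : nat) (h : 'I_m -> 'rV[R]_n -> R) :
  (forall k, continuous (h k)) -> continuous (fun x => \sum_(k < m) h k x).
Proof.
move=> ch; elim: m h ch => [|m IH] h ch.
  by rewrite (_ : (fun x => _) = cst 0); [exact: cst_continuous|apply/funext => x; rewrite big_ord0].
rewrite (_ : (fun x => _) = (fun x => h ord0 x + \sum_(k < m) h (lift ord0 k) x)); last first.
  by apply/funext => x; rewrite big_ord_recl.
by apply: contD => //; apply: IH.
Qed.

Lemma cont_comp1 (g : R -> R) f : continuous f -> (forall x, {for f x, continuous g}) ->
  continuous (fun x => g (f x)).
Proof. by move=> cf cg x; exact: (cvg_comp _ _ (cf x) (cg x)). Qed.

Lemma cont_powR f (r : R) : continuous f -> (forall x, 0 < f x) ->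
  continuous (fun x => f x `^ r).
Proof.
move=> cf f0; apply: (@cont_comp1 (fun y : R => y `^ r)) => // x.
apply/differentiable_continuous/derivable1_diffP.
exact: (@ex_derive _ _ _ _ _ _ _ (is_derive1_powR r (f0 x))).
Qed.

Lemma is_derive_pow f (x e : 'rV[R]_n) (r df : R) : 0 < f x -> is_derive x e f df ->
  is_derive x e (fun y => f y `^ r) (r * f x `^ (r - 1) * df).
Proof.
by move=> f0 Df; apply: (@is_derive_comp1 _ _ (fun y : R => y `^ r)) => //; exact: is_derive1_powR.
Qed.

(** Closed under linear combinations, so that the integral of a combination of
    divergences is computed once, for the whole combination. *)
Definition null_integral f := test_fun f /\ intR f = 0.

Lemma null_integralD f g : null_integral f -> null_integral g -> null_integral (fun x => f x + g x).
Proof. by move=> [cf f0] [cg g0]; split; [exact: test_funD|rewrite intRD // f0 g0 addr0]. Qed.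

Lemma null_integralZ c f : null_integral f -> null_integral (fun x => c * f x).
Proof. by move=> [cf f0]; split; [exact: test_funZ|rewrite intRZ // f0 mulr0]. Qed.

Lemma null_integral_sum (m : nat) (h : 'I_m -> 'rV[R]_n -> R) :
  (forall k, null_integral (h k)) -> null_integral (fun x => \sum_(k < m) h k x).
Proof.
move=> ch; elim: m h ch => [|m IH] h ch.
  rewrite (_ : (fun x => _) = cst 0); last by apply/funext => x; rewrite big_ord0.
  split; first by split; [exact: cst_continuous|exists 0].
  by rewrite /intR Rintegral_cst // mul0r.
rewrite (_ : (fun x => _) = (fun x => h ord0 x + \sum_(k < m) h (lift ord0 k) x)); last first.
  by apply/funext => x; rewrite big_ord_recl.
by apply: null_integralD => //; apply: IH.
Qed.

End continuity.

Section identity.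
Context {R : realType} {n : nat}.
Local Notation e i := (delta_mx 0 i : 'rV[R]_n).
Context (v : 'rV[R]_n -> R) (a : 'I_n -> 'rV[R]_n -> R) (H : 'I_n -> 'I_n -> 'rV[R]_n -> R)
  (phi : 'rV[R]_n -> R) (f d : 'I_n -> 'rV[R]_n -> R).
Context (v0 : forall x, 0 < v x) (cv : continuous v) (ca : forall i, continuous (a i))
  (cH : forall i j, continuous (H i j)) (ccphi : test_fun phi)
  (cf : forall i, continuous (f i)) (cd : forall i, continuous (d i)).
Context (Dv : forall i x, is_derive x (e i) v (a i x))
  (Da : forall i j x, is_derive x (e j) (a i) (H i j x))
  (Dphi : forall i x, is_derive x (e i) phi (f i x))
  (Df : forall i x, is_derive x (e i) (f i) (d i x)).

Definition gradsq x := \sum_(k < n) a k x * a k x.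

Definition dgradsq i x := \sum_(k < n) 2 * (a k x * H k i x).

Lemma cont_gradsq : continuous gradsq.
Proof. by apply: cont_sum => k; apply: contM. Qed.

Lemma cont_dgradsq i : continuous (dgradsq i).
Proof. by apply: cont_sum => k; apply: contM; [exact: contC|exact: contM]. Qed.

Lemma is_derive_gradsq i x : is_derive x (e i) gradsq (dgradsq i x).
Proof.
apply: (@is_derive_bigsum _ _ n (fun k x => a k x * a k x) (fun k x => 2 * (a k x * H k i x))) => k.
by apply: (is_derive_eq (is_derive_mul (Da k i x) (Da k i x))); ring.
Qed.

Definition powv r x := v x `^ r.

Lemma cont_powv r : continuous (powv r).
Proof. exact: cont_powR. Qed.

Lemma is_derive_powv r i x : is_derive x (e i) (powv r) (r * powv (r - 1) x * a i x).
Proof. exact: is_derive_pow. Qed.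

Context (s k1 k3 : R).

(** Derivative along [j] of the [i]-th component of phi v^(-s) grad v. *)
Definition dweighted_grad j i x := phi x * (powv (- s) x * H i j x + a i x * (- s * powv (- s - 1) x * a j x))
  + powv (- s) x * a i x * f j x.

Lemma cont_dweighted_grad j i : continuous (dweighted_grad j i).
Proof.
have cp := ccphi.1; have cw := @cont_powv (- s); have cw1 := @cont_powv (- s - 1).
exact: (contD (contM cp (contD (contM cw (@cH i j)) (contM (@ca i)
  (contM (contM (@contC _ _ (- s)) cw1) (@ca j))))) (contM (contM cw (@ca i)) (@cf j))).
Qed.

Lemma is_derive_weighted_grad j i x :
  is_derive x (e j) (fun x => phi x * (powv (- s) x * a i x)) (dweighted_grad j i x).
Proof.
apply: (is_derive_eq (is_derive_mul (Dphi j x)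
  (is_derive_mul (is_derive_powv (- s) j x) (Da i j x)))).
by rewrite /dweighted_grad; ring.
Qed.

Lemma test_fun_weighted_grad i : test_fun (fun x => phi x * (powv (- s) x * a i x)).
Proof. by apply: test_funM => //; apply: contM; [exact: cont_powv|]. Qed.

Lemma null_integral_lagrangian i j : null_integral (fun x => dweighted_grad i i x * H j j x + -1 * (dweighted_grad j i x * H j i x)).
Proof.
have cWd k : test_fun (dweighted_grad k i) by apply: (test_fun_derive (test_fun_weighted_grad i) (@cont_dweighted_grad k i)) => x; exact: is_derive_weighted_grad.
have c1 := test_funM (cWd i) (@cH j j); have c2 := test_funM (cWd j) (@cH j i).
split; first by apply: test_funD => //; exact: test_funZ.
rewrite intRD //; last exact: test_funZ.
have E := intR_null_lagrangian (test_fun_weighted_grad i) (@cont_dweighted_grad i i) (@cont_dweighted_grad j i) (ca (i := j))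
  (@cH j i) (@cH j j) (is_derive_weighted_grad i i) (is_derive_weighted_grad j i) (Da j i) (Da j j).
by rewrite intRZ // E mulN1r subrr.
Qed.

(** Derivative along [i] of the [i]-th component of phi v^(-s-1) |grad v|^2 grad v. *)
Definition dcubic_field i x := phi x * (powv (- s - 1) x * (gradsq x * H i i x + a i x * dgradsq i x)
   + gradsq x * a i x * ((- s - 1) * powv (- s - 2) x * a i x))
  + powv (- s - 1) x * (gradsq x * a i x) * f i x.

Lemma null_integral_cubic i : null_integral (dcubic_field i).
Proof.
have cp := ccphi.1.
have cF : test_fun (fun x => phi x * (powv (- s - 1) x * (gradsq x * a i x))).
  apply: test_funM => //; apply: contM; first exact: cont_powv.
  by apply: contM; [exact: cont_gradsq|].
have cdF : continuous (dcubic_field i).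
  have cw1 := @cont_powv (- s - 1); have cw2 := @cont_powv (- s - 2).
  exact: (contD (contM cp (contD (contM cw1 (contD (contM cont_gradsq (@cH i i))
    (contM (@ca i) (@cont_dgradsq i)))) (contM (contM cont_gradsq (@ca i))
    (contM (contM (@contC _ _ (- s - 1)) cw2) (@ca i)))))
    (contM (contM cw1 (contM cont_gradsq (@ca i))) (@cf i))).
have D x : is_derive x (e i) (fun x => phi x * (powv (- s - 1) x * (gradsq x * a i x))) (dcubic_field i x).
  apply: (is_derive_eq (is_derive_mul (Dphi i x) (is_derive_mul (is_derive_powv (- s - 1) i x)
    (is_derive_mul (is_derive_gradsq i x) (Da i i x))))).
  by rewrite /dcubic_field (_ : - s - 2 = - s - 1 - 1); ring.
by split; [exact: (test_fun_derive cF cdF D)|exact: (intR_partial0 cF cdF D)].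
Qed.

(** Derivative along [i] of the [i]-th component of v^(-s) |grad v|^2 grad phi. *)
Definition dcutoff_field i x := f i x * (powv (- s) x * dgradsq i x
   + gradsq x * (- s * powv (- s - 1) x * a i x))
  + powv (- s) x * gradsq x * d i x.

Lemma null_integral_cutoff i : null_integral (dcutoff_field i).
Proof.
have cF : test_fun (fun x => f i x * (powv (- s) x * gradsq x)).
  apply: test_funM; first by apply: (test_fun_derive ccphi (@cf i)) => x; exact: Dphi.
  by apply: contM; [exact: cont_powv|exact: cont_gradsq].
have cdF : continuous (dcutoff_field i).
  have cw := @cont_powv (- s); have cw1 := @cont_powv (- s - 1).
  exact: (contD (contM (@cf i) (contD (contM cw (@cont_dgradsq i)) (contM cont_gradsq
    (contM (contM (@contC _ _ (- s)) cw1) (@ca i))))) (contM (contM cw cont_gradsq) (@cd i))).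
have D x : is_derive x (e i) (fun x => f i x * (powv (- s) x * gradsq x)) (dcutoff_field i x).
  apply: (is_derive_eq (is_derive_mul (Df i x) (is_derive_mul (is_derive_powv (- s) i x)
    (is_derive_gradsq i x)))).
  by rewrite /dcutoff_field; ring.
by split; [exact: (test_fun_derive cF cdF D)|exact: (intR_partial0 cF cdF D)].
Qed.

(** Derivative along [i] of the [i]-th component of phi v^(1+s) grad v. *)
Definition dpower_field i x := phi x * (powv (1 + s) x * H i i x
   + a i x * ((1 + s) * powv s x * a i x))
  + powv (1 + s) x * a i x * f i x.

Lemma null_integral_power i : null_integral (dpower_field i).
Proof.
have cp := ccphi.1.
have cF : test_fun (fun x => phi x * (powv (1 + s) x * a i x)).
  by apply: test_funM => //; apply: contM; [exact: cont_powv|].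
have cdF : continuous (dpower_field i).
  have cw := @cont_powv (1 + s); have cw1 := @cont_powv s.
  exact: (contD (contM cp (contD (contM cw (@cH i i)) (contM (@ca i)
    (contM (contM (@contC _ _ (1 + s)) cw1) (@ca i))))) (contM (contM cw (@ca i)) (@cf i))).
have D x : is_derive x (e i) (fun x => phi x * (powv (1 + s) x * a i x)) (dpower_field i x).
  apply: (is_derive_eq (is_derive_mul (Dphi i x) (is_derive_mul (is_derive_powv (1 + s) i x)
    (Da i i x)))).
  by rewrite /dpower_field (_ : 1 + s - 1 = s); ring.
by split; [exact: (test_fun_derive cF cdF D)|exact: (intR_partial0 cF cdF D)].
Qed.

(** The divergence of the cubic field cancels the terms D^2 v (grad v, grad v),
    that of the cutoff field the terms D^2 v (grad v, grad phi); the last one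
    replaces phi v^(1+s) Delta v, which the equation produces out of
    (Delta v)^2, by first order terms. *)
Definition gs_combination x :=
  \sum_(i < n) \sum_(j < n) (dweighted_grad i i x * H j j x + -1 * (dweighted_grad j i x * H j i x))
  + (- k1 * (\sum_(i < n) dcubic_field i x) + (2^-1 * (\sum_(i < n) dcutoff_field i x) + k3 * \sum_(i < n) dpower_field i x)).

Lemma null_integral_gs : null_integral gs_combination.
Proof.
apply: null_integralD.
  by apply: null_integral_sum => i; apply: null_integral_sum => j; exact: null_integral_lagrangian.
apply: null_integralD; first by apply: null_integralZ; apply: null_integral_sum => i; exact: null_integral_cubic.
apply: null_integralD; first by apply: null_integralZ; apply: null_integral_sum => i; exact: null_integral_cutoff.
by apply: null_integralZ; apply: null_integral_sum => i; exact: null_integral_power.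
Qed.

(** The sums over coordinates enter only through a few scalars, which turns the
    pointwise estimate into an inequality between real numbers.  The symmetry of
    [H] makes the contractions from the different fields agree. *)
Lemma gs_combinationE (sym : forall i j x, H i j x = H j i x) x :
  let L := \sum_(i < n) H i i x in let g := gradsq x in
  let b := \sum_(i < n) a i x * f i x in
  let Hvv := \sum_(i < n) \sum_(j < n) a i x * a j x * H i j x in
  let Hvf := \sum_(i < n) \sum_(j < n) a i x * f j x * H i j x in
  let HH := \sum_(i < n) \sum_(j < n) H i j x * H i j x in
  let D := \sum_(i < n) d i x in
  let w := powv (- s) x in let w1 := powv (- s - 1) x in let w2 := powv (- s - 2) x in
  let p1 := powv (1 + s) x in let p0 := powv s x in
  gs_combination x =
   (w * b * L - s * w1 * phi x * g * L + phi x * w * (L * L) - w * Hvf + s * phi x * w1 * Hvv - phi x * w * HH)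
   - k1 * (w1 * g * b - (s + 1) * phi x * w2 * (g * g) + 2 * phi x * w1 * Hvv + phi x * w1 * g * L)
   + 2^-1 * (w * g * D + 2 * w * Hvf - s * w1 * g * b)
   + k3 * (p1 * b + (1 + s) * phi x * p0 * g + phi x * p1 * L).
Proof.
move=> L g b Hvv Hvf HH D w w1 w2 p1 p0.
have Eg : gradsq x = g by [].
have Eg2 : g = \sum_(k < n) a k x * a k x by [].
clearbody g.
have EHvv : \sum_(i < n) a i x * dgradsq i x = 2 * Hvv.
  rewrite /Hvv mulr_sumr; apply: eq_bigr => i _; rewrite /dgradsq !mulr_sumr.
  by apply: eq_bigr => j _; rewrite (sym j i); ring.
have EHvf : \sum_(i < n) f i x * dgradsq i x = 2 * Hvf.
  rewrite /Hvf exchange_big mulr_sumr; apply: eq_bigr => i _; rewrite /dgradsq !mulr_sumr.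
  by apply: eq_bigr => j _; ring.
have E0 : \sum_(i < n) \sum_(j < n) (dweighted_grad i i x * H j j x + -1 * (dweighted_grad j i x * H j i x)) =
  (phi x * w * L + - s * phi x * w1 * g + w * b) * L
  + -1 * (phi x * w * HH + - s * phi x * w1 * Hvv + w * Hvf).
  transitivity (\sum_(i < n) ((phi x * w * H i i x + - s * phi x * w1 * (a i x * a i x) + w * (a i x * f i x)) * L
     + -1 * (phi x * w * (\sum_(j < n) H i j x * H i j x) + - s * phi x * w1 * (\sum_(j < n) a i x * a j x * H i j x)
     + w * (\sum_(j < n) a i x * f j x * H i j x)))).
    apply: eq_bigr => i _; rewrite big_split /= -!mulr_sumr; congr (_ * _ + _ * _).
      by rewrite /dweighted_grad -/w -/w1; ring.
    rewrite !mulr_sumr -!big_split /=; apply: eq_bigr => j _.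
    by rewrite /dweighted_grad -/w -/w1 (sym j i); ring.
  by rewrite big_split /= -mulr_suml -mulr_sumr !big_split /= -!mulr_sumr -Eg2.
have E1 : \sum_(i < n) dcubic_field i x = phi x * w1 * g * L + phi x * w1 * (2 * Hvv)
   + phi x * (- s - 1) * w2 * g * g + w1 * g * b.
  have -> : phi x * (- s - 1) * w2 * g * g = phi x * (- s - 1) * w2 * g * (\sum_(k < n) a k x * a k x) by rewrite -Eg2.
  rewrite -EHvv /L /b !mulr_sumr -!big_split /=; apply: eq_bigr => i _.
  by rewrite /dcubic_field -/w1 -/w2 Eg; ring.
have E2 : \sum_(i < n) dcutoff_field i x = w * (2 * Hvf) + - s * w1 * g * b + w * g * D.
  rewrite -EHvf /b /D !mulr_sumr -!big_split /=; apply: eq_bigr => i _.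
  by rewrite /dcutoff_field -/w -/w1 Eg; ring.
have E3 : \sum_(i < n) dpower_field i x = phi x * p1 * L + phi x * (1 + s) * p0 * g + p1 * b.
  have -> : phi x * (1 + s) * p0 * g = phi x * (1 + s) * p0 * (\sum_(k < n) a k x * a k x) by rewrite -Eg2.
  rewrite /L /b !mulr_sumr -!big_split /=; apply: eq_bigr => i _.
  by rewrite /dpower_field -/p1 -/p0; ring.
by rewrite /gs_combination E0 E1 E2 E3; field.
Qed.

End identity.

(** * Algebra of the pointwise estimate *)

Lemma sqr_sum_le (R : realFieldType) (n : nat) (q : 'I_n -> R) :
  (\sum_i q i) ^+ 2 <= n%:R * \sum_i q i ^+ 2.
Proof.
have H : 0 <= \sum_i \sum_j (q i - q j) ^+ 2.
  by apply: sumr_ge0 => i _; apply: sumr_ge0 => j _; exact: sqr_ge0.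
have E : \sum_i \sum_j (q i - q j) ^+ 2 = 2 * (n%:R * (\sum_i q i ^+ 2) - (\sum_i q i) ^+ 2).
  transitivity (\sum_(i < n) (q i ^+ 2 * n%:R + ((\sum_(j < n) q j ^+ 2) - 2 * q i * \sum_(j < n) q j))).
    apply: eq_bigr => i _.
    transitivity (\sum_(j < n) (q i ^+ 2 + (q j ^+ 2 - 2 * q i * q j))).
      by apply: eq_bigr => j _; ring.
    by rewrite big_split /= sumr_const card_ord mulr_natr sumrB -mulr_sumr.
  rewrite big_split /= -mulr_suml sumrB sumr_const card_ord -mulr_suml -mulr_sumr -mulr_natr.
  by ring.
by move: H; rewrite E; lra.
Qed.

(** The trace inequality (tr Q)^2 <= n |Q|^2 for Q = H + c a (x) a. *)
Lemma sqr_trace_le (R : realFieldType) (n : nat) (a : 'I_n -> R) (H : 'I_n -> 'I_n -> R) (c : R) :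
  let L := \sum_i H i i in let g := \sum_i a i * a i in
  let Hvv := \sum_i \sum_j a i * a j * H i j in
  let HH := \sum_i \sum_j H i j * H i j in
  is_true ((L + c * g) ^+ 2 <= n%:R * (HH + 2 * c * Hvv + c ^+ 2 * g ^+ 2)).
Proof.
move=> L g Hvv HH.
pose Q i j := H i j + c * (a i * a j).
have -> : L + c * g = \sum_i Q i i by rewrite big_split /= -mulr_sumr.
apply: le_trans (sqr_sum_le _) _; apply: ler_wpM2l => //.
have -> : HH + 2 * c * Hvv + c ^+ 2 * g ^+ 2 = \sum_i \sum_j Q i j ^+ 2.
  rewrite /HH /Hvv [g ^+ 2]expr2 [in RHS](eq_bigr (fun i => \sum_j H i j * H i j + 2 * c * (\sum_j a i * a j * H i j)
       + c ^+ 2 * ((a i * a i) * g))); last first.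
    move=> i _; rewrite /g !mulr_sumr -!big_split /=; apply: eq_bigr => j _.
    by rewrite /Q; ring.
  by rewrite !big_split /= -!mulr_sumr -mulr_suml.
apply: ler_sum => i _; rewrite (bigD1 i) //= lerDl.
by apply: sumr_ge0 => j _; exact: sqr_ge0.
Qed.

(** With a = - (s / 2 + b1), the last quantity is
    ((N - 1) p - b1 (N + 2)) / N + e1 (1 + s), so b1 must exceed
    b0 = (N - 1) p / (N + 2); at b1 = b0 the third quantity is [A0], negative
    in the subcritical range because of the factorization [A0E].  A small
    [t] = b1 - b0 > 0 keeps it negative and leaves room for [e1] > 0. *)
Lemma gs_constants (R : realFieldType) (N p : R) : 2 <= N -> 1 < p -> (N - 2) * p < N + 2 ->
  let s := (p - 1) / 2 in
  exists a e1 c : R, [/\ 0 < c, c <= e1,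
    (1 - N^-1) * a ^+ 2 + (a + s / 2) * (s + 1) <= - c &
    ((1 - N^-1) + e1) * (1 + s) - (- s - 2 * a / N - (a + s / 2)) <= 0].
Proof.
move=> N2 p1 hp s.
have N0 : N != 0 by lra.
have N20 : N + 2 != 0 by lra.
pose b0 := (N - 1) * p / (N + 2).
pose A0 := (1 - N^-1) * (s / 2 + b0) ^+ 2 - b0 * (s + 1).
have A0E : A0 = - ((N - 1) * ((N + 2 - (N - 2) * p) * ((17 * N - 2) * p - (N + 2))) / (16 * N * (N + 2) ^+ 2)).
  by rewrite /A0 /b0 /s; field; rewrite N0 N20.
have A0neg : A0 < 0.
  rewrite A0E oppr_lt0; apply: divr_gt0.
    apply: mulr_gt0; first by lra.
    by apply: mulr_gt0; [lra|nra].
  by apply: mulr_gt0; [lra|rewrite exprn_gt0 //; lra].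
have b00 : 0 < b0 by rewrite /b0 divr_gt0 // ?mulr_gt0; lra.
have s0 : 0 < s by rewrite /s; lra.
pose K := s + 2 * b0 + 1.
have K0 : 0 < K by rewrite /K; lra.
pose t := Num.min 1 (- A0 / (2 * K)).
have t0 : 0 < t by rewrite /t lt_min ltr01 /= divr_gt0 //; lra.
have t1 : t <= 1 by rewrite /t ge_min lexx.
have tK : t * K <= - A0 / 2.
  have : t <= - A0 / (2 * K) by rewrite /t ge_min lexx orbT.
  rewrite ler_pdivlMr; last by lra.
  by move=> h; nra.
pose b1 := b0 + t.
pose e1 := t * (N + 2) / (N * (1 + s)).
have e10 : 0 < e1 by rewrite /e1 divr_gt0 // mulr_gt0; lra.
have Ni : 0 < N^-1 <= 1 by rewrite invr_gt0 invf_le1; lra.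
exists (- (s / 2 + b1)), e1, (Num.min e1 (- A0 / 2)); split.
- by rewrite lt_min e10 /=; lra.
- by rewrite ge_min lexx.
- apply: (@le_trans _ _ (A0 / 2)); last first.
    have : Num.min e1 (- A0 / 2) <= - A0 / 2 by rewrite ge_min lexx orbT.
    by lra.
  have -> : (1 - N^-1) * (- (s / 2 + b1)) ^+ 2 + (- (s / 2 + b1) + s / 2) * (s + 1) =
     A0 + t * ((1 - N^-1) * (s + 2 * b0 + t) - (s + 1)).
    by rewrite /A0 /b1; field.
  have H : (1 - N^-1) * (s + 2 * b0 + t) - (s + 1) <= K.
    have : 0 <= N^-1 * (s + 2 * b0 + t) by apply: mulr_ge0; lra.
    by rewrite /K; lra.
  have : t * ((1 - N^-1) * (s + 2 * b0 + t) - (s + 1)) <= t * K by apply: ler_wpM2l; lra.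
  by lra.
- rewrite le_eqVlt; apply/orP; left; apply/eqP.
  rewrite /e1 /b1 /b0 /s; field.
  by rewrite N0 N20 /=; apply/eqP; lra.
Qed.

(** Substituting Delta v = v l, grad v . grad phi = v bh, |grad v|^2 = (v y)^2
    and v^s = z makes every term v^2 / z times a polynomial in (y, z, l).  The
    choice k1 = a + s / 2 is the one for which [Hvv] cancels after the trace
    inequality is applied to [HH]. *)
Lemma gs_combination_le (R : realFieldType) (N v z y l bh phi a s k3 Hvv Hvf HH D : R) :
  0 < N -> 0 < v -> 0 < z -> 0 <= phi ->
  let L := v * l in let b := v * bh in let g := (v * y) ^+ 2 in
  let w := z^-1 in let w1 := z^-1 / v in let w2 := z^-1 / v ^+ 2 in
  let p1 := v * z in let p0 := z in let k1 := a + s / 2 in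
  (L + a / v * g) ^+ 2 <= N * (HH + 2 * (a / v) * Hvv + (a / v) ^+ 2 * g ^+ 2) ->
   (w * b * L - s * w1 * phi * g * L + phi * w * (L * L) - w * Hvf + s * phi * w1 * Hvv - phi * w * HH)
   - k1 * (w1 * g * b - (s + 1) * phi * w2 * (g * g) + 2 * phi * w1 * Hvv + phi * w1 * g * L)
   + 2^-1 * (w * g * D + 2 * w * Hvf - s * w1 * g * b)
   + k3 * (p1 * b + (1 + s) * phi * p0 * g + phi * p1 * L)
  <= v ^+ 2 / z * (phi * ((1 - N^-1) * l ^+ 2 + (- s - 2 * a / N - k1) * y ^+ 2 * l
     + ((1 - N^-1) * a ^+ 2 + k1 * (s + 1)) * y ^+ 4 + k3 * ((1 + s) * z ^+ 2 * y ^+ 2 + z ^+ 2 * l))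
     + bh * (l - (s / 2 + k1) * y ^+ 2 + k3 * z ^+ 2) + y ^+ 2 * D / 2).
Proof.
move=> N0 v0 z0 phi0 L b g w w1 w2 p1 p0 k1 H.
have w0 : 0 < w by rewrite invr_gt0.
have H' : - (phi * w * HH) <= phi * w * (2 * (a / v) * Hvv + (a / v) ^+ 2 * g ^+ 2 - (L + a / v * g) ^+ 2 / N).
  rewrite -mulrN; apply: ler_wpM2l; first by apply: mulr_ge0 => //; exact: ltW.
  have : (L + a / v * g) ^+ 2 / N <= HH + 2 * (a / v) * Hvv + (a / v) ^+ 2 * g ^+ 2.
    by rewrite ler_pdivrMr // [leRHS]mulrC.
  by lra.
have vn : v != 0 by lra. have zn : z != 0 by lra. have Nn : N != 0 by lra.
set X := (X in X <= _); set Y := (Y in _ <= Y).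
suff -> : Y = X + phi * w * HH + phi * w * (2 * (a / v) * Hvv + (a / v) ^+ 2 * g ^+ 2 - (L + a / v * g) ^+ 2 / N).
  by lra.
rewrite /X /Y /k1 /p1 /p0 /w2 /w1 /w /g /b /L; field.
by rewrite vn zn Nn.
Qed.

Lemma quartic_le (R : realFieldType) (y z : R) : (y + z) ^+ 4 <= 8 * (y ^+ 4 + z ^+ 4).
Proof.
have h1 : (y + z) ^+ 2 <= 2 * (y ^+ 2 + z ^+ 2) by have := sqr_ge0 (y - z); lra.
have -> : (y + z) ^+ 4 = (y + z) ^+ 2 * (y + z) ^+ 2 by rewrite -exprD.
apply: le_trans (ler_pM (sqr_ge0 _) (sqr_ge0 _) h1 h1) _.
have -> : y ^+ 4 = y ^+ 2 * y ^+ 2 by rewrite -exprD.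
have -> : z ^+ 4 = z ^+ 2 * z ^+ 2 by rewrite -exprD.
by have := sqr_ge0 (y ^+ 2 - z ^+ 2); lra.
Qed.

Lemma main_terms_le (R : realFieldType) (y z A E G c : R) :
  0 <= c -> c <= E -> A <= - c -> G <= 0 ->
  - E * z ^+ 4 + A * y ^+ 4 + G * (z ^+ 2 * y ^+ 2) <= - (c / 8) * (y + z) ^+ 4.
Proof.
move=> c0 cE Ac G0.
have y40 : 0 <= y ^+ 4 by rewrite exprn_even_ge0.
have z40 : 0 <= z ^+ 4 by rewrite exprn_even_ge0.
have h1 : (E - c) * z ^+ 4 >= 0 by rewrite mulr_ge0 // subr_ge0.
have h2 : A * y ^+ 4 <= - c * y ^+ 4 by rewrite ler_wpM2r.
have h3 : G * (z ^+ 2 * y ^+ 2) <= 0 by rewrite mulr_le0_ge0 // mulr_ge0 // sqr_ge0.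
have h4 : c * (y + z) ^+ 4 <= c * (8 * (y ^+ 4 + z ^+ 4)) by rewrite ler_wpM2l // quartic_le.
by lra.
Qed.

(** The part of the drift quadratic in T is multiplied by the small constant [e];
    everything else is of degree 3. *)
Lemma drift_terms_le (R : realFieldType) (T Y Z P Q B eh Lam e kk c : R) :
  1 <= T -> 0 <= Y <= T ^+ 2 -> 0 <= Z <= T ^+ 2 -> `|P| + `|B| <= kk -> 0 <= Q <= 1 ->
  `|eh| <= Lam * T + e * T ^+ 2 -> 0 <= Lam -> 0 <= e <= 1 -> 16 * (e * (kk + 1)) <= c ->
  eh * (P * Z + Q * eh + B * Y) <= Lam * (kk + 2 + Lam) * T ^+ 3 + c / 16 * T ^+ 4.
Proof.
move=> T1 /andP[Y0 YT] /andP[Z0 ZT] PB /andP[Q0 Q1] ehT Lam0 /andP[e0 e1] ec.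
have T0 : 0 <= T by exact: le_trans ler01 T1.
have T20 : 0 <= T ^+ 2 by exact: sqr_ge0.
have kk0 : 0 <= kk by apply: le_trans PB; rewrite addr_ge0.
have TT2 : T <= T ^+ 2 by rewrite expr2 ler_peMl.
have LT : Lam * T <= Lam * T ^+ 2 by rewrite ler_wpM2l.
have LT0 : 0 <= Lam * T by rewrite mulr_ge0.
have eT0 : 0 <= e * T ^+ 2 by rewrite mulr_ge0.
have eT : e * T ^+ 2 <= T ^+ 2 by rewrite ler_piMl.
have h1 : `|P * Z + Q * eh + B * Y| <= kk * T ^+ 2 + `|eh|.
  apply: le_trans (ler_normD _ _) _; apply: le_trans (lerD (ler_normD _ _) (lexx _)) _.
  rewrite !normrM (ger0_norm Z0) (ger0_norm Y0) (ger0_norm Q0).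
  have h1 : `|P| * Z <= `|P| * T ^+ 2 by rewrite ler_wpM2l.
  have h2 : `|B| * Y <= `|B| * T ^+ 2 by rewrite ler_wpM2l.
  have h3 : Q * `|eh| <= `|eh| by rewrite ler_piMl.
  have h4 : (`|P| + `|B|) * T ^+ 2 <= kk * T ^+ 2 by rewrite ler_wpM2r.
  by clear - h1 h2 h3 h4; lra.
apply: le_trans (ler_norm _) _; rewrite normrM.
have kT0 : 0 <= kk * T ^+ 2 by rewrite mulr_ge0.
apply: le_trans (ler_wpM2l (normr_ge0 eh) h1) _.
have h2 : kk * T ^+ 2 + `|eh| <= (kk + 1 + Lam) * T ^+ 2 by clear - ehT LT eT; lra.
have h3 : `|eh| * (kk * T ^+ 2 + `|eh|) <= (Lam * T + e * T ^+ 2) * (kk * T ^+ 2 + `|eh|).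
  by rewrite ler_wpM2r // addr_ge0.
apply: le_trans h3 _; rewrite mulrDl.
have h4 : Lam * T * (kk * T ^+ 2 + `|eh|) <= Lam * T * ((kk + 1 + Lam) * T ^+ 2).
  by rewrite ler_wpM2l.
have h5 : e * T ^+ 2 * (kk * T ^+ 2 + `|eh|) <= e * T ^+ 2 * (kk * T ^+ 2 + (Lam * T + e * T ^+ 2)).
  by rewrite ler_wpM2l // lerD2l.
have h6 : e * T ^+ 2 * (Lam * T) <= T ^+ 2 * (Lam * T) by rewrite ler_wpM2r.
have h7 : e * T ^+ 2 * (e * T ^+ 2) <= T ^+ 2 * (e * T ^+ 2) by rewrite ler_wpM2r.
have h8 : 16 * (e * (kk + 1)) * (T ^+ 2 * T ^+ 2) <= c * (T ^+ 2 * T ^+ 2).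
  by rewrite ler_wpM2r // mulr_ge0.
have T3E : T ^+ 3 = T * T ^+ 2 by rewrite -exprS.
have T4E : T ^+ 4 = T ^+ 2 * T ^+ 2 by rewrite -exprD.
by rewrite T3E T4E; clear - h4 h5 h6 h7 h8; lra.
Qed.

Lemma gradient_terms_le (R : realFieldType) (T y Y Z P B bh eh Lam K psi kk : R) :
  1 <= T -> 0 <= y <= T -> 0 <= Y <= T ^+ 2 -> 0 <= Z <= T ^+ 2 ->
  `|P| + `|B| <= kk ->
  `|eh| <= Lam * T + T ^+ 2 -> 0 <= Lam -> 0 <= K -> 0 <= psi -> `|bh| <= K * psi * y ->
  bh * (P * Z + eh + B * Y) <= K * (kk + 1 + Lam) * psi * T ^+ 3.
Proof.
move=> T1 /andP[y0 yT] /andP[Y0 YT] /andP[Z0 ZT] PB ehT Lam0 K0 psi0 bhK.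
have T0 : 0 <= T by exact: le_trans ler01 T1.
have TT2 : T <= T ^+ 2 by rewrite expr2 ler_peMl.
have kk0 : 0 <= kk by apply: le_trans PB; rewrite addr_ge0.
have LT : Lam * T <= Lam * T ^+ 2 by rewrite ler_wpM2l.
have h1 : `|P * Z + eh + B * Y| <= (kk + 1 + Lam) * T ^+ 2.
  apply: le_trans (ler_normD _ _) _; apply: le_trans (lerD (ler_normD _ _) (lexx _)) _.
  rewrite !normrM (ger0_norm Z0) (ger0_norm Y0).
  have h1 : `|P| * Z <= `|P| * T ^+ 2 by rewrite ler_wpM2l.
  have h2 : `|B| * Y <= `|B| * T ^+ 2 by rewrite ler_wpM2l.
  have h4 : (`|P| + `|B|) * T ^+ 2 <= kk * T ^+ 2 by rewrite ler_wpM2r // sqr_ge0.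
  by clear - h1 h2 h4 ehT LT; lra.
apply: le_trans (ler_norm _) _; rewrite normrM.
apply: le_trans (ler_pM (normr_ge0 _) (normr_ge0 _) bhK h1) _.
have -> : K * psi * y * ((kk + 1 + Lam) * T ^+ 2) = K * (kk + 1 + Lam) * psi * (y * T ^+ 2) by ring.
rewrite exprS ler_wpM2l //; last by rewrite ler_wpM2r // sqr_ge0.
by rewrite mulr_ge0 // mulr_ge0 // !addr_ge0.
Qed.

(** Here eh is the deviation of l = Delta v / v from its leading part - z^2; it
    has degree 1 in T up to a small multiple of z^2.  [psi] stands for eta^(m-2),
    the size of the derivatives of the cutoff [phi]. *)
Lemma scaled_combination_le (R : realFieldType) (y z phi psi bh D eh T A B k3 k2 K Lam e e1 c s N1 kk : R) :
  0 < c -> c <= e1 -> A <= - c -> k3 = N1 + e1 -> 0 <= N1 <= 1 -> k3 * (1 + s) - B <= 0 ->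
  0 <= y -> 1 <= z -> T = y + z -> 0 <= phi -> phi <= psi ->
  `|bh| <= K * psi * y -> `|D| <= K * psi -> `|eh| <= Lam * T + e * z ^+ 2 ->
  0 <= Lam -> 0 <= e <= 1 -> 0 <= K -> `|B| + `|k2| + k3 + 3 <= kk -> 16 * (e * (kk + 1)) <= c ->
  phi * (N1 * (- z ^+ 2 + eh) ^+ 2 + B * y ^+ 2 * (- z ^+ 2 + eh) + A * y ^+ 4
    + k3 * ((1 + s) * z ^+ 2 * y ^+ 2 + z ^+ 2 * (- z ^+ 2 + eh)))
    + bh * ((- z ^+ 2 + eh) - k2 * y ^+ 2 + k3 * z ^+ 2) + y ^+ 2 * D / 2
  <= - (c / 16) * phi * T ^+ 4 + (Lam * (kk + 2 + Lam) + K * (kk + 2 + Lam)) * psi * T ^+ 3.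
Proof.
move=> c0 ce1 Ac k3E /andP[N10 N11] hB y0 z1 TE phi0 phipsi bhK DK ehK Lam0 /andP[e0 e1'] K0 Bkk ekk.
have z0 : 0 <= z by exact: le_trans ler01 z1.
have T1 : 1 <= T by rewrite TE -[leLHS]add0r lerD.
have T0 : 0 <= T by exact: le_trans ler01 T1.
have psi0 : 0 <= psi by exact: le_trans phi0 phipsi.
have yT : y <= T by rewrite TE lerDl.
have zT : z <= T by rewrite TE lerDr.
have z2T : 0 <= z ^+ 2 <= T ^+ 2 by rewrite sqr_ge0 ler_sqr.
have y2T : 0 <= y ^+ 2 <= T ^+ 2 by rewrite sqr_ge0 ler_sqr.
have k30 : 0 <= k3 by rewrite k3E addr_ge0 // (le_trans (ltW c0)).
have T23 : T ^+ 2 <= T ^+ 3 by rewrite [leRHS]exprS ler_peMl // sqr_ge0.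
have T30 : 0 <= T ^+ 3 by rewrite exprn_ge0.
have ehT : `|eh| <= Lam * T + e * T ^+ 2.
  by apply: le_trans ehK _; rewrite lerD2l ler_wpM2l //; case/andP: z2T.
have ehT' : `|eh| <= Lam * T + T ^+ 2.
  by apply: le_trans ehT _; rewrite lerD2l ler_piMl // sqr_ge0.
have -> : N1 * (- z ^+ 2 + eh) ^+ 2 + B * y ^+ 2 * (- z ^+ 2 + eh) + A * y ^+ 4
    + k3 * ((1 + s) * z ^+ 2 * y ^+ 2 + z ^+ 2 * (- z ^+ 2 + eh)) =
    (- e1 * z ^+ 4 + A * y ^+ 4 + (k3 * (1 + s) - B) * (z ^+ 2 * y ^+ 2))
    + eh * ((k3 - 2 * N1) * z ^+ 2 + N1 * eh + B * y ^+ 2).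
  by rewrite k3E; ring.
have -> : (- z ^+ 2 + eh) - k2 * y ^+ 2 + k3 * z ^+ 2 =
   (k3 - 1) * z ^+ 2 + eh + (- k2) * y ^+ 2 by ring.
have k31 : `|k3 - 1| <= k3 + 1 by apply: le_trans (ler_normB _ _) _; rewrite normr1 ger0_norm.
have k3N : `|k3 - 2 * N1| <= k3 + 2.
  by apply: le_trans (ler_normB _ _) _; rewrite !ger0_norm ?mulr_ge0 // lerD2l ler_piMr.
have B0 := normr_ge0 B; have k20 := normr_ge0 k2.
have PB : `|k3 - 2 * N1| + `|B| <= kk by clear - k3N Bkk k20; lra.
have PB' : `|k3 - 1| + `|- k2| <= kk by rewrite normrN; clear - k31 Bkk B0; lra.
have M1 := main_terms_le y z (ltW c0) ce1 Ac hB.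
rewrite -TE in M1.
have M2 := drift_terms_le (Q := N1) T1 y2T z2T PB (introT andP (conj N10 N11)) ehT Lam0
  (introT andP (conj e0 e1')) ekk.
have M3 := gradient_terms_le T1 (introT andP (conj y0 yT)) y2T z2T PB' ehT' Lam0 K0 psi0 bhK.
have M4 : y ^+ 2 * D <= K * psi * T ^+ 3.
  apply: le_trans (ler_norm _) _; rewrite normrM (ger0_norm (sqr_ge0 y)) mulrC.
  apply: (ler_pM (normr_ge0 _) (sqr_ge0 _) DK); apply: le_trans (T23); by case/andP: y2T.
have M5 : 0 <= K * psi * T ^+ 3 by rewrite mulr_ge0 // mulr_ge0.
have M6 : 0 <= Lam * (kk + 2 + Lam) * T ^+ 3.
  have kk0 : 0 <= kk by apply: le_trans PB; rewrite addr_ge0.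
  by rewrite !mulr_ge0 // !addr_ge0.
have M7 := ler_wpM2l phi0 (lerD M1 M2).
have M8 := ler_wpM2r M6 phipsi.
by clear - M3 M4 M5 M7 M8; lra.
Qed.

(** If eta^2 T is large, the quartic term dominates.  Otherwise eta^2 T <= Q, and
    the error, a multiple of at most T^(3 + 2 k0) eta^(m-2), is bounded by a power
    of Q since m - 2 >= 2 (3 + 2 k0). *)
Lemma absorb_cubic_term (R : realFieldType) (v z y T eta c C3 : R) (m k0 : nat) :
  0 < c -> 0 <= C3 -> 0 <= eta -> eta <= 1 -> 1 <= v -> 1 <= z -> 0 <= y -> T = y + z ->
  v <= T ^+ k0 -> (2 + 2 * (3 + 2 * k0) <= m)%N ->
  v ^+ 2 / z * (- (c / 16) * eta ^+ m * T ^+ 4 + C3 * eta ^+ (m - 2) * T ^+ 3) <=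
  - (c / 32) * (eta ^+ m * ((v * z) ^+ 2 + (v * y) ^+ 2)) + C3 * (32 * C3 / c) ^+ (3 + 2 * k0).
Proof.
move=> c0 C30 eta0 eta1 v1 z1 y0 TE vT mk.
set M := (3 + 2 * k0)%N in mk *; set Q := 32 * C3 / c.
have Q0 : 0 <= Q by rewrite /Q divr_ge0 // ?mulr_ge0 //; lra.
have T1 : 1 <= T by lra.
have T0 : 0 < T by lra.
have v20 : 0 <= v ^+ 2 by exact: sqr_ge0.
have phi0 : 0 <= eta ^+ m by exact: exprn_ge0.
have psi0 : 0 <= eta ^+ (m - 2) by exact: exprn_ge0.
have om0 : 0 <= v ^+ 2 / z by rewrite divr_ge0 //; lra.
have T30 : 0 <= T ^+ 3 by rewrite exprn_ge0 // ltW.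
have omv : v ^+ 2 / z <= v ^+ 2.
  by rewrite ler_pdivrMr; [rewrite ler_peMr|lra].
have good : (v * z) ^+ 2 + (v * y) ^+ 2 <= v ^+ 2 / z * T ^+ 4.
  have h0 : z ^+ 2 + y ^+ 2 <= T ^+ 2 by rewrite TE; have := mulr_ge0 y0 (_ : 0 <= z); lra.
  have h1 : (v * z) ^+ 2 + (v * y) ^+ 2 = v ^+ 2 * (z ^+ 2 + y ^+ 2) by ring.
  rewrite h1 -mulrA; apply: ler_wpM2l => //; apply: le_trans h0 _.
  rewrite mulrC ler_pdivlMr; last by lra.
  have -> : T ^+ 4 = T ^+ 2 * T ^+ 2 by rewrite -exprD.
  apply: ler_wpM2l; first exact: sqr_ge0.
  by rewrite expr2; nra.
have key : v ^+ 2 / z * (C3 * eta ^+ (m - 2) * T ^+ 3) <=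
   (c / 32) * (v ^+ 2 / z * (eta ^+ m * T ^+ 4)) + C3 * Q ^+ M.
  have [h|h] := leP Q (eta ^+ 2 * T).
    have hC : C3 <= (c / 32) * (eta ^+ 2 * T).
      by move: h; rewrite /Q ler_pdivrMr //; lra.
    have E : (c / 32) * (v ^+ 2 / z * (eta ^+ m * T ^+ 4)) =
       v ^+ 2 / z * ((c / 32 * (eta ^+ 2 * T)) * eta ^+ (m - 2) * T ^+ 3).
      have -> : eta ^+ m = eta ^+ 2 * eta ^+ (m - 2).
        by rewrite -exprD subnKC // (leq_trans _ mk).
      by ring.
    have h2 : v ^+ 2 / z * (C3 * eta ^+ (m - 2) * T ^+ 3) <=
       v ^+ 2 / z * ((c / 32 * (eta ^+ 2 * T)) * eta ^+ (m - 2) * T ^+ 3).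
      by apply: ler_wpM2l => //; apply: ler_wpM2r => //; apply: ler_wpM2r.
    rewrite E; apply: le_trans h2 _; rewrite lerDl; apply: mulr_ge0 => //; exact: exprn_ge0.
  apply: (@le_trans _ _ (C3 * Q ^+ M)); last first.
    rewrite lerDr; apply: mulr_ge0; first by lra.
    by apply: mulr_ge0 => //; apply: mulr_ge0 => //; rewrite exprn_ge0 // ltW.
  apply: (@le_trans _ _ (T ^+ (2 * k0) * (C3 * eta ^+ (m - 2) * T ^+ 3))).
    apply: ler_wpM2r; first by apply: mulr_ge0 => //; exact: mulr_ge0.
    apply: le_trans omv _; rewrite mulnC exprM; apply: lerXn2r => //; rewrite nnegrE; first by lra.
    by rewrite exprn_ge0 // ltW.
  have -> : T ^+ (2 * k0) * (C3 * eta ^+ (m - 2) * T ^+ 3) = C3 * ((eta ^+ 2 * T) ^+ M * eta ^+ (m - 2 - 2 * M)).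
    have -> : eta ^+ (m - 2) = eta ^+ (2 * M) * eta ^+ (m - 2 - 2 * M).
      by rewrite -exprD subnKC // leq_subRL // (leq_trans _ mk).
    by rewrite exprMn -exprM [T ^+ M]exprD; ring.
  apply: ler_wpM2l => //; rewrite -[leRHS]mulr1; apply: ler_pM.
  - by apply: exprn_ge0; apply: mulr_ge0; [exact: sqr_ge0|exact: ltW].
  - exact: exprn_ge0.
  - apply: lerXn2r; rewrite ?nnegrE // ?(ltW h) //.
    by apply: mulr_ge0; [exact: sqr_ge0|exact: ltW].
  - exact: exprn_ile1.
have h1 : eta ^+ m * ((v * z) ^+ 2 + (v * y) ^+ 2) <= eta ^+ m * (v ^+ 2 / z * T ^+ 4) by apply: ler_wpM2l.
have h2 : c / 32 * (eta ^+ m * ((v * z) ^+ 2 + (v * y) ^+ 2)) <= c / 32 * (eta ^+ m * (v ^+ 2 / z * T ^+ 4)).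
  by apply: ler_wpM2l => //; lra.
by lra.
Qed.

(** * Lower order terms and cutoff functions *)

(** The mean value theorem for t^p; the case u = 0 is apart because powers are
    differentiated at positive points only. *)
Lemma powR_diff_le (R : realType) (u p : R) : 0 <= u -> 1 <= p ->
  0 <= (u + 1) `^ p - u `^ p <= p * (u + 1) `^ (p - 1).
Proof.
move=> u0 p1; have p0 : 0 <= p by lra.
rewrite subr_ge0 ge0_ler_powR ?nnegrE //; [|lra|lra].
rewrite le_eqVlt in u0; case/orP: u0 => [/eqP <-|u0].
  by rewrite add0r !powR1 powR0 ?subr0 ?mulr1 //; lra.
have D (t : R) : t \in `]u, (u + 1)[ -> is_derive t (1:R) (fun t : R => t `^ p) (p * t `^ (p - 1)).
  by rewrite in_itv /= => /andP[ut _]; apply: is_derive1_powR; lra.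
have C : {within `[u, (u + 1)], continuous (fun t : R => t `^ p)}.
  apply: derivable_within_continuous => t; rewrite in_itv /= => /andP[ut _].
  exact: (@ex_derive _ _ _ _ _ _ _ (is_derive1_powR p (lt_le_trans u0 ut))).
have [|c + ->] := MVT_segment _ D C; first by lra.
rewrite in_itv /= => /andP[uc cu].
have -> : u + 1 - u = 1 by lra.
rewrite mulr1; apply: ler_wpM2l => //.
by apply: ge0_ler_powR; rewrite ?nnegrE //; lra.
Qed.

(** By the previous bound the left-hand side is at most p v^(p-2).  For v >= p / e
    this is below e v^(p-1); for v < p / e the constant dominates it. *)
Lemma lower_order_le (R : realType) (u p e : R) : 0 <= u -> 1 < p -> 0 < e ->
  let v := u + 1 in
  is_true ((v `^ p - u `^ p) / v <= e * (v `^ ((p - 1) / 2)) ^+ 2 + p * ((p / e) `^ (p - 1))).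
Proof.
move=> u0 p1 e0 v; have v1 : 1 <= v by rewrite /v; lra.
have v0 : 0 < v by lra.
have E : (v `^ ((p - 1) / 2)) ^+ 2 = v `^ (p - 1).
  by rewrite -powR_mulrn ?powR_ge0 // -powRrM divfK // pnatr_eq0.
have /andP[_ H] := powR_diff_le u0 (ltW p1).
have w0 : 0 <= v `^ (p - 1) by exact: powR_ge0.
have q0 : 0 <= (p / e) `^ (p - 1) by exact: powR_ge0.
rewrite E ler_pdivrMr //; apply: le_trans H _; rewrite -/v.
have [h|h] := leP p (e * v).
  apply: (@le_trans _ _ ((e * v) * v `^ (p - 1))); first by apply: ler_wpM2r.
  have : 0 <= p * ((p / e) `^ (p - 1)) * v by rewrite !mulr_ge0 //; lra.
  by lra.
have h1 : v `^ (p - 1) <= (p / e) `^ (p - 1).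
  apply: ge0_ler_powR; rewrite ?nnegrE; [lra|lra| |].
    by rewrite divr_ge0; lra.
  by rewrite ler_pdivlMr // mulrC ltW.
have h2 : p * v `^ (p - 1) <= p * (p / e) `^ (p - 1) by apply: ler_wpM2l => //; lra.
have h3 : p * (p / e) `^ (p - 1) <= p * (p / e) `^ (p - 1) * v.
  by rewrite ler_peMr // mulr_ge0 //; lra.
have h4 : 0 <= e * v `^ (p - 1) * v by rewrite !mulr_ge0 // ltW.
by lra.
Qed.

Section cutoff_function.
Context {R : realType} {n : nat}.
Local Notation e i := (delta_mx 0 i : 'rV[R]_n).

(** The derivatives of powers of [cutoff] are again polynomials times powers of
    [cutoff]. *)
Definition cutoff (r : R) (x : 'rV[R]_n) : R := Num.max 0 (1 - dot x x / r ^+ 2).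

Lemma dot_ge0 (x : 'rV[R]_n) : 0 <= dot x x.
Proof. by apply: sumr_ge0 => i _; exact: sqr_ge0. Qed.

Lemma sqr_coord_le_dot (x : 'rV[R]_n) i : x 0 i ^+ 2 <= dot x x.
Proof.
by rewrite /dot (bigD1 i) //= lerDl; apply: sumr_ge0 => j _; exact: sqr_ge0.
Qed.

Lemma lt_norm_le_dot r (x : 'rV[R]_n) : 0 <= r -> r < `|x| -> r ^+ 2 <= dot x x.
Proof.
move=> r0 rx; have [i xi] : exists i, r < `|x 0 i|.
  apply: contrapT => /forallNP h; move: rx; apply/negP; rewrite -leNgt.
  by apply: norm_le_coord => // i; rewrite leNgt; apply/negP.
apply: le_trans (sqr_coord_le_dot x i).
by rewrite -[leRHS]real_normK ?num_real // ler_sqr ?nnegrE // ltW.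
Qed.

Lemma cont_coord (i : 'I_n) : continuous (fun x : 'rV[R]_n => x 0 i : R).
Proof. exact: coord_continuous. Qed.

Lemma cont_dot : continuous (fun x : 'rV[R]_n => dot x x).
Proof. by apply: cont_sum => i; apply: contM; exact: cont_coord. Qed.

Lemma cutoff_ge0 r x : 0 <= cutoff r x. Proof. by rewrite le_max lexx. Qed.

Lemma cutoff_le1 r x : cutoff r x <= 1.
Proof.
by rewrite ge_max ler01 /= gerBl divr_ge0 ?dot_ge0 ?sqr_ge0.
Qed.

Lemma cutoff_eq0 r x : 0 < r -> r ^+ 2 <= dot x x -> cutoff r x = 0.
Proof.
move=> r0 h; apply/max_l; rewrite subr_le0 ler_pdivlMr ?mul1r //.
exact: exprn_gt0.
Qed.

Lemma cont_cutoff r : continuous (cutoff r).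
Proof.
move=> x.
have := @continuous_max _ _ (fun _ : 'rV[R]_n => 0 : R) (fun x : 'rV[R]_n => 1 - dot x x / r ^+ 2) x.
apply; first exact: cst_continuous.
apply: (@contD _ _ (fun=> 1) (fun x => - (dot x x / r ^+ 2))); first exact: contC.
exact: (contN (contM cont_dot (@contC _ _ (r ^- 2)))).
Qed.

Lemma cont_cutoffX r m : continuous (fun x => cutoff r x ^+ m).
Proof.
apply: (@cont_comp1 _ _ (fun y : R => y ^+ m)); first exact: cont_cutoff.
by move=> x; exact: exprn_continuous.
Qed.

Lemma is_derive_cutoffX r m i x :
  is_derive x (e i) (fun x => cutoff r x ^+ m.+2)
   (m.+2%:R * cutoff r x ^+ m.+1 * (- (2 * x 0 i / r ^+ 2))).
Proof.
have D : is_derive x (e i) (fun x : 'rV[R]_n => 1 + (- r ^- 2) * dot x x) (0 + (- r ^- 2) * (2 * x 0 i)).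
  exact: (is_derive_add (is_derive_cst (1 : R) x (e i)) (is_derive_scale (- r ^- 2) (is_derive_dot i x))).
have E y : 1 + (- r ^- 2) * dot y y = 1 - dot y y / r ^+ 2 by rewrite mulNr [_^-1 * _]mulrC.
have := is_derive_comp1 D (is_derive_relu m (1 + (- r ^- 2) * dot x x)).
rewrite E (_ : (fun y => _) = (fun x => cutoff r x ^+ m.+2)); last first.
  by apply/funext => y; rewrite E.
by move=> D'; apply: (is_derive_eq D'); rewrite add0r mulNr [_^-1 * _]mulrC.
Qed.

(** First and second derivatives of the power m + 4 of the cutoff. *)
Definition cutoff1 r m i x := m.+4%:R * cutoff r x ^+ m.+3 * (- (2 * x 0 i / r ^+ 2)).

Definition cutoff2 r m i x := m.+4%:R * (cutoff r x ^+ m.+3 * - (2 / r ^+ 2) +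
  (- (2 * x 0 i / r ^+ 2)) * (m.+3%:R * cutoff r x ^+ m.+2 * (- (2 * x 0 i / r ^+ 2)))).

Lemma cont_cutoff_slope r i : continuous (fun x : 'rV[R]_n => - (2 * x 0 i / r ^+ 2)).
Proof.
exact: (contN (contM (contM (@contC _ _ 2) (@cont_coord i)) (@contC _ _ (r ^- 2)))).
Qed.

Lemma cont_cutoff1 r m i : continuous (cutoff1 r m i).
Proof. exact: (contM (contM (@contC _ _ m.+4%:R) (@cont_cutoffX r m.+3)) (@cont_cutoff_slope r i)). Qed.

Lemma cont_cutoff2 r m i : continuous (cutoff2 r m i).
Proof.
exact: (contM (@contC _ _ m.+4%:R) (contD (contM (@cont_cutoffX r m.+3) (@contC _ _ (- (2 / r ^+ 2))))
  (contM (@cont_cutoff_slope r i) (contM (contM (@contC _ _ m.+3%:R) (@cont_cutoffX r m.+2)) (@cont_cutoff_slope r i))))).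
Qed.

Lemma is_derive_cutoff1 r m i x : is_derive x (e i) (cutoff1 r m i) (cutoff2 r m i x).
Proof.
have D : is_derive x (e i) (fun x : 'rV[R]_n => (- (2 / r ^+ 2)) * x 0 i) ((- (2 / r ^+ 2)) * (i == i)%:R).
  exact: (is_derive_scale (- (2 / r ^+ 2)) (is_derive_coord i i x)).
have := is_derive_scale m.+4%:R (is_derive_mul (is_derive_cutoffX r m.+1 i x) D).
rewrite (_ : (fun y => _) = cutoff1 r m i); last first.
  by apply/funext => y; rewrite /cutoff1; move: (r ^+ 2)^-1 => c; ring.
by move=> D'; apply: (is_derive_eq D'); rewrite /cutoff2 eqxx mulr1; move: (r ^+ 2)^-1 => c; ring.
Qed.

Lemma test_fun_cutoff r m : 0 < r -> test_fun (fun x => cutoff r x ^+ m.+1).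
Proof.
move=> r0; split; first exact: cont_cutoffX.
exists r => x rx; by rewrite cutoff_eq0 ?expr0n // lt_norm_le_dot // ltW.
Qed.

Lemma coord_le r (x : 'rV[R]_n) i : 0 <= r -> dot x x <= r ^+ 2 -> `|x 0 i| <= r.
Proof.
move=> r0 h; rewrite -ler_sqr ?nnegrE // real_normK ?num_real //.
exact: le_trans (sqr_coord_le_dot x i) h.
Qed.

Lemma cutoff_slope_le r (x : 'rV[R]_n) i : 1 <= r -> dot x x <= r ^+ 2 -> `|- (2 * x 0 i / r ^+ 2)| <= 2.
Proof.
move=> r1 h; have r0 : 0 < r by lra.
rewrite normrN !normrM normfV (ger0_norm (sqr_ge0 r)) ger0_norm // -mulrA.
rewrite -[leRHS]mulr1; apply: ler_wpM2l => //.
rewrite ler_pdivrMr ?exprn_gt0 // mul1r; apply: le_trans (coord_le i (ltW r0) h) _.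
by rewrite expr2 ler_peMl // ltW.
Qed.

Lemma cutoff1_le r m i x : 1 <= r -> dot x x <= r ^+ 2 ->
  `|cutoff1 r m i x| <= 4 * m.+4%:R ^+ 2 * cutoff r x ^+ m.+2.
Proof.
move=> r1 h; rewrite /cutoff1 normrM.
have e0 := cutoff_ge0 r x.
have m1 : (1 : R) <= m.+4%:R by rewrite ler1n.
rewrite ger0_norm; last by rewrite mulr_ge0 // exprn_ge0.
have h1 : cutoff r x ^+ m.+3 <= cutoff r x ^+ m.+2.
  by rewrite exprS ler_piMl ?exprn_ge0 // cutoff_le1.
have h0 : 0 <= cutoff r x ^+ m.+2 by rewrite exprn_ge0.
apply: (@le_trans _ _ (m.+4%:R * cutoff r x ^+ m.+2 * 2)).
  apply: ler_pM => //; [by rewrite mulr_ge0 // exprn_ge0|by rewrite ler_wpM2l|exact: cutoff_slope_le].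
have : m.+4%:R * cutoff r x ^+ m.+2 <= m.+4%:R ^+ 2 * cutoff r x ^+ m.+2.
  by rewrite ler_wpM2r // expr2 ler_peMl.
have : 0 <= m.+4%:R * cutoff r x ^+ m.+2 by rewrite mulr_ge0.
by lra.
Qed.

Lemma cutoff2_le r m i x : 1 <= r -> dot x x <= r ^+ 2 ->
  `|cutoff2 r m i x| <= 4 * m.+4%:R ^+ 2 * cutoff r x ^+ m.+2.
Proof.
move=> r1 h; rewrite /cutoff2.
have e0 := cutoff_ge0 r x.
have m1 : (4 : R) <= m.+4%:R by rewrite ler_nat.
set k : R := m.+4%:R in m1 *.
have -> : (m.+3%:R : R) = k - 1 by rewrite /k -[in RHS]natr1 addrK.
have h1 : cutoff r x ^+ m.+3 <= cutoff r x ^+ m.+2.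
  by rewrite exprS ler_piMl ?exprn_ge0 // cutoff_le1.
have h0 : 0 <= cutoff r x ^+ m.+2 by rewrite exprn_ge0.
have h03 : 0 <= cutoff r x ^+ m.+3 by rewrite exprn_ge0.
set E := cutoff r x ^+ m.+2 in h0 h1 *; set E3 := cutoff r x ^+ m.+3 in h1 h03 *.
have l2 := cutoff_slope_le i r1 h; set l := - (2 * x 0 i / r ^+ 2) in l2 *.
have r2 : 0 <= 2 / r ^+ 2 <= 2.
  by rewrite divr_ge0 ?sqr_ge0 //= ler_pdivrMr ?exprn_gt0 ?ler_peMr ?expr_ge1 //; lra.
have b1 : `|E3 * - (2 / r ^+ 2)| <= E * 2.
  case/andP: r2 => r20 r22; rewrite normrM normrN (ger0_norm h03) (ger0_norm r20).
  by apply: ler_pM.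
have b2 : `|l * ((k - 1) * E * l)| <= 4 * ((k - 1) * E).
  have k1 : 0 <= (k - 1) * E by rewrite mulr_ge0 // subr_ge0; lra.
  rewrite mulrCA normrM (ger0_norm k1) normrM mulrC; apply: ler_wpM2r => //.
  by have := ler_pM (normr_ge0 _) (normr_ge0 _) l2 l2; lra.
rewrite normrM (ger0_norm (_ : 0 <= k)); last by lra.
have b3 : `|E3 * - (2 / r ^+ 2) + l * ((k - 1) * E * l)| <= 4 * k * E.
  by apply: le_trans (ler_normD _ _) _; lra.
have -> : 4 * k ^+ 2 * E = k * (4 * k * E) by ring.
by apply: ler_wpM2l => //; lra.
Qed.

End cutoff_function.

Section box_bound.
Context {R : realType} {n : nat}.

Lemma intR_le_box (f : 'rV[R]_n -> R) r M : 0 <= r -> 0 <= M -> test_fun f ->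
  (forall x, f x <= M) -> (forall x, r < `|x| -> f x <= 0) ->
  intR f <= M * (2 * r) ^+ n.
Proof.
move=> r0 M0 cf fM f0.
have -> : M * (2 * r) ^+ n = \int[@lebesgue_tuple R n]_t (M * \1_(box r) t).
  rewrite RintegralZl //; last first.
    have := @integrable_box R n r 1 r0.
    by under eq_fun do rewrite mul1r.
  rewrite /Rintegral integral_indic //; last exact: measurable_box.
  by rewrite setIT; congr (_ * _); exact: (congr1 fine (esym (@measure_box R n r r0))).
apply: le_Rintegral => //.
- exact: test_fun_integrable.
- exact: integrable_box.
move=> t _; rewrite indicE; case: (boolP (t \in box r)) => /= [_|].
  by rewrite mulr1.
rewrite notin_setE => tr; rewrite mulr0; apply: f0; rewrite ltNge; apply/negP => h.
by apply: tr; apply/boxP.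
Qed.
End box_bound.

(** * The local estimate *)

Lemma subcritical (R : realType) (n : nat) (p : R) : (2 <= n)%N ->
  (p%:E < p_star R n)%E -> (n%:R - 2) * p < n%:R + 2.
Proof.
move=> n2; rewrite /p_star; case: ifP => [n2' _|/negbT].
  have -> : n = 2%N by apply/eqP; rewrite eqn_leq n2'.
  by rewrite subrr mul0r; lra.
rewrite -ltnNge => n3; rewrite lte_fin ltr_pdivlMr ?[p * _]mulrC //.
by rewrite subr_gt0 ltr_nat.
Qed.

Lemma norm_sum_le (R : realType) (n : nat) (F : 'I_n -> R) (M : R) :
  (forall i, `|F i| <= M) -> `|\sum_i F i| <= n%:R * M.
Proof.
move=> FM; apply: le_trans (ler_norm_sum _ _ _) _.
apply: le_trans (ler_sum _ (fun i _ => FM i)) _.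
by rewrite sumr_const card_ord mulr_natl.
Qed.

Section solution.
Context (R : realType) (n : nat) (p lambda beta : R) (u : 'rV[R]_n -> R).
Context (hn : (2 <= n)%N) (p1 : 1 < p)
  (l0 : 0 < lambda) (b0 : 0 <= beta) (u0 : forall x, 0 <= u x)
  (hu : classical_solution lambda beta p u).
Local Notation e i := (delta_mx 0 i : 'rV[R]_n).

(** Adding 1 bounds all negative powers, also where [u] vanishes, and changes the
    equation only by terms of order below v^p. *)
Definition lifted x := u x + 1.
Definition dpart i := partial i u.
Definition hess i j := partial j (partial i u).
Definition hexp := (p - 1) / 2.
Definition lpow x := lifted x `^ hexp.

Lemma lifted_ge1 x : 1 <= lifted x. Proof. by rewrite /lifted lerDr. Qed.
Lemma lifted_gt0 x : 0 < lifted x. Proof. exact: lt_le_trans ltr01 (lifted_ge1 x). Qed.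

Lemma cont_lifted : continuous lifted.
Proof. by case: hu => -[cu _] _; apply: contD => //; exact: contC. Qed.

Lemma cont_dpart i : continuous (dpart i).
Proof. by case: hu => -[_ /(_ i)[_ []]]. Qed.

Lemma cont_hess i j : continuous (hess i j).
Proof. by case: hu => -[_ /(_ i)[_ [_ /(_ j)[_ []]]]]. Qed.

Lemma Ddpart i j x : is_derive x (e j) (dpart i) (hess i j x).
Proof. by apply: DeriveDef => //; case: hu => -[_ /(_ i)[_ [_ /(_ j)[]]]]. Qed.

Lemma Du i x : is_derive x (e i) u (dpart i x).
Proof. by apply: DeriveDef => //; case: hu => -[_ /(_ i)[]]. Qed.

Lemma Dlifted i x : is_derive x (e i) lifted (dpart i x).
Proof.
have := is_derive_add (Du i x) (is_derive_cst (1 : R) x (e i)).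
by rewrite addr0.
Qed.

Lemma hess_sym i j x : hess i j x = hess j i x.
Proof.
exact: (partial_sym (Du i) (Du j) (Ddpart i j) (Ddpart j i) (@cont_hess i j) (@cont_hess j i)).
Qed.

Lemma hexp_gt0 : 0 < hexp. Proof. by rewrite divr_gt0 // subr_gt0. Qed.
Lemma lpow_ge1 x : 1 <= lpow x.
Proof. by rewrite -(powRr0 (lifted x)) ler_powR ?lifted_ge1 // ltW // hexp_gt0. Qed.
Lemma lpow_gt0 x : 0 < lpow x. Proof. exact: lt_le_trans ltr01 (lpow_ge1 x). Qed.

Lemma lifted_powR x : lifted x `^ p = lifted x * lpow x ^+ 2.
Proof.
have -> : lpow x ^+ 2 = lifted x `^ (p - 1).
  by rewrite /lpow -powR_mulrn ?powR_ge0 // -powRrM /hexp divfK // pnatr_eq0.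
by rewrite mulr_powRB1 // ?(ltW (lifted_gt0 x)) // (lt_trans ltr01 p1).
Qed.

Lemma powNhexp x : powv lifted (- hexp) x = (lpow x)^-1. Proof. exact: powRN. Qed.

Lemma powNhexpB1 x : powv lifted (- hexp - 1) x = (lpow x)^-1 / lifted x.
Proof.
rewrite /powv powRB; last by rewrite (gt_eqF (lifted_gt0 x)) implybT.
by rewrite powRN powRr1 // ltW // lifted_gt0.
Qed.

Lemma powNhexpB2 x : powv lifted (- hexp - 2) x = (lpow x)^-1 / lifted x ^+ 2.
Proof.
rewrite /powv powRB; last by rewrite (gt_eqF (lifted_gt0 x)) implybT.
by rewrite powRN (@powR_mulrn _ _ 2) // ltW // lifted_gt0.
Qed.

Lemma pow1Dhexp x : powv lifted (1 + hexp) x = lifted x * lpow x.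
Proof.
rewrite /powv powRD; last by rewrite (gt_eqF (lifted_gt0 x)) implybT.
by rewrite powRr1 // ltW // lifted_gt0.
Qed.

(** As [lifted * lpow] squared is the power p + 1 of u + 1, this dominates the
    integrand of the theorem without its weight. *)
Definition energy x := (lifted x * lpow x) ^+ 2 + gradsq dpart x.

Lemma cont_energy : continuous energy.
Proof.
have cz : continuous lpow by apply: cont_powR; [exact: cont_lifted|exact: lifted_gt0].
have cvz := contM cont_lifted cz.
exact: (contD (contM cvz cvz) (@cont_gradsq _ _ _ cont_dpart)).
Qed.

Lemma gradsq_ge0 x : 0 <= gradsq dpart x.
Proof. by apply: sumr_ge0 => i _; rewrite -expr2 sqr_ge0. Qed.

Lemma equation x : \sum_i hess i i x = lambda * (\sum_i x 0 i * dpart i x) - u x `^ p + beta * u x.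
Proof.
have E2 : dot x (grad u x) = \sum_i x 0 i * dpart i x.
  by apply: eq_bigr => i _; rewrite /grad mxE.
by case: hu => _ /(_ x); rewrite /laplacian E2 /hess; lra.
Qed.

Section local_bound.
Context (A0 e1 c : R).
Context (c0 : 0 < c) (ce1 : c <= e1)
  (hA : (1 - n%:R^-1) * A0 ^+ 2 + (A0 + hexp / 2) * (hexp + 1) <= - c)
  (hB : ((1 - n%:R^-1) + e1) * (1 + hexp) - (- hexp - 2 * A0 / n%:R - (A0 + hexp / 2)) <= 0).

Let k1 : R := A0 + hexp / 2.
Let k3 : R := (1 - n%:R^-1) + e1.
Let B : R := - hexp - 2 * A0 / n%:R - k1.
(** [ep] is the share of the quartic term that the lower order terms may take,
    [Ce] what remains of these, [kk] a bound for the coefficients, [K] one for the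
    derivatives of the cutoff; [C0] r^2 multiplies the cubic errors. *)
Let kk : R := `|B| + `|hexp / 2 + k1| + k3 + 3.
Let ep : R := Num.min 1 (c / (16 * (kk + 1))).
Let Ce : R := beta + p * ((p / ep) `^ (p - 1)).
Let L0 : R := n%:R * lambda + Ce.
Context (k0 : nat) (hk0 : 1 <= hexp * k0%:R).
Let m := (4 + 4 * k0)%N.
Let K : R := n%:R * (4 * m.+4%:R ^+ 2).
Let C0 : R := (L0 + K) * (kk + 2 + L0).

Let n_ge2 : 2 <= n%:R :> R. Proof. by rewrite ler_nat. Qed.

Let k30 : 0 <= k3.
Proof.
rewrite /k3 addr_ge0 //; last exact: le_trans (ltW c0) ce1.
by rewrite subr_ge0 invf_le1; have := n_ge2; lra.
Qed.

Let kk0 : 0 <= kk. Proof. apply: addr_ge0 => //; apply: addr_ge0; [exact: addr_ge0|exact: k30]. Qed.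

Let ep_gt0 : 0 < ep.
Proof. by rewrite /ep lt_min ltr01 divr_gt0 // mulr_gt0 //; have := kk0; lra. Qed.

Let Ce0 : 0 <= Ce.
Proof. by rewrite /Ce addr_ge0 ?b0 // mulr_ge0 ?powR_ge0 // ltW // (lt_trans ltr01 p1). Qed.

Let L00 : 0 <= L0. Proof. apply: addr_ge0; [exact: mulr_ge0 (ler0n _ _) (ltW l0)|exact: Ce0]. Qed.

Let K0 : 0 <= K. Proof. by rewrite /K !mulr_ge0 ?exprn_ge0. Qed.

Let C00 : 0 <= C0.
Proof.
apply: mulr_ge0; first exact: addr_ge0 L00 K0.
by apply: addr_ge0 L00; apply: addr_ge0 => //; exact: kk0.
Qed.

Definition gs_form (r : R) := gs_combination lifted dpart hess
  (fun x => cutoff r x ^+ m.+4) (cutoff1 r m) (cutoff2 r m) hexp k1 k3.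

Lemma gs_form_outside r x : 0 < r -> r ^+ 2 <= dot x x -> gs_form r x = 0.
Proof.
move=> r0 xr; have E := cutoff_eq0 r0 xr.
rewrite /gs_form gs_combinationE; last exact: hess_sym.
have f0 i : cutoff1 r m i x = 0 by rewrite /cutoff1 E expr0n mulr0 mul0r.
have d0 i : cutoff2 r m i x = 0 by rewrite /cutoff2 E !expr0n !(mulr0, mul0r) addr0 mulr0.
rewrite E expr0n /=.
have -> : \sum_(i < n) dpart i x * cutoff1 r m i x = 0 by rewrite big1 // => i _; rewrite f0 mulr0.
have -> : \sum_(i < n) \sum_(j < n) dpart i x * cutoff1 r m j x * hess i j x = 0.
  by rewrite big1 // => i _; rewrite big1 // => j _; rewrite f0 mulr0 mul0r.
have -> : \sum_(i < n) cutoff2 r m i x = 0 by rewrite big1.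
by ring.
Qed.

(** The last term is the constant bound for the region where the cubic errors are
    not absorbed; it grows polynomially in [r]. *)
Lemma gs_form_inside r x : 1 <= r -> dot x x <= r ^+ 2 ->
  gs_form r x <= - (c / 32) * (cutoff r x ^+ m.+4 * energy x)
    + (C0 * r ^+ 2) * (32 * (C0 * r ^+ 2) / c) ^+ (3 + 2 * k0).
Proof.
move=> r1 xr.
have r0 : 0 <= r by exact: le_trans ler01 r1.
have vx := lifted_gt0 x; have zx := lpow_gt0 x; have zx1 := lpow_ge1 x; have vx1 := lifted_ge1 x.
have vn := lt0r_neq0 vx.
pose y := Num.sqrt (gradsq dpart x) / lifted x.
have y0 : 0 <= y by rewrite /y divr_ge0 ?sqrtr_ge0 // ltW.
have gE : gradsq dpart x = (lifted x * y) ^+ 2.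
  by rewrite /y mulrCA divff // mulr1 sqr_sqrtr // gradsq_ge0.
have ay i : `|dpart i x| <= lifted x * y.
  rewrite /y mulrCA divff // mulr1 -[leLHS]sqrtr_sqr ler_wsqrtr //.
  by rewrite /gradsq (bigD1 i) //= -expr2 lerDl sumr_ge0 // => j _; rewrite -expr2 sqr_ge0.
pose T := y + lpow x.
pose L := \sum_i hess i i x.
pose b := \sum_(i < n) dpart i x * cutoff1 r m i x.
pose D := \sum_(i < n) cutoff2 r m i x.
pose bh := b / lifted x.
pose l := L / lifted x.
pose eh := l + lpow x ^+ 2.
have phi0 : 0 <= cutoff r x ^+ m.+4 by rewrite exprn_ge0 // cutoff_ge0.
have psi0 : 0 <= cutoff r x ^+ m.+2 by rewrite exprn_ge0 // cutoff_ge0.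
have phipsi : cutoff r x ^+ m.+4 <= cutoff r x ^+ m.+2.
  by rewrite exprS [in leLHS]exprS mulrA ler_piMl // mulr_ile1 ?cutoff_ge0 ?cutoff_le1.
have bhK : `|bh| <= K * cutoff r x ^+ m.+2 * y.
  rewrite /bh normrM normfV (gtr0_norm vx) ler_pdivrMr //.
  have -> : K * cutoff r x ^+ m.+2 * y * lifted x = n%:R * (lifted x * y * (4 * m.+4%:R ^+ 2 * cutoff r x ^+ m.+2)).
    by rewrite /K; ring.
  by apply: norm_sum_le => i; rewrite normrM ler_pM // cutoff1_le.
have DK : `|D| <= K * cutoff r x ^+ m.+2.
  by rewrite /K -mulrA; apply: norm_sum_le => i; exact: cutoff2_le.
(* The equation turns eh into the drift lambda x . grad v / v and lower order terms. *)
have ehK : `|eh| <= L0 * r * T + ep * lpow x ^+ 2.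
  have -> : eh = lambda * ((\sum_i x 0 i * dpart i x) / lifted x) + (beta * (u x / lifted x) + (lifted x `^ p - u x `^ p) / lifted x).
    rewrite /eh /l /L equation lifted_powR; field; exact: vn.
  have xa : `|(\sum_i x 0 i * dpart i x) / lifted x| <= n%:R * r * y.
    rewrite normrM normfV (gtr0_norm vx) ler_pdivrMr //.
    have -> : n%:R * r * y * lifted x = n%:R * (r * (lifted x * y)) by ring.
    by apply: norm_sum_le => i; rewrite normrM ler_pM // coord_le.
  have uv : 0 <= u x / lifted x <= 1.
    by rewrite divr_ge0 ?u0 ?(ltW vx) //= ler_pdivrMr // mul1r /lifted lerDl.
  have /andP[dp0 _] := powR_diff_le (u0 x) (ltW p1).
  have lo := lower_order_le (u0 x) p1 ep_gt0.
  apply: le_trans (ler_normD _ _) _.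
  have h1 : `|lambda * ((\sum_i x 0 i * dpart i x) / lifted x)| <= lambda * (n%:R * r * y).
    by rewrite normrM (gtr0_norm l0) ler_wpM2l // ltW.
  have h2 : `|beta * (u x / lifted x) + (lifted x `^ p - u x `^ p) / lifted x| <= Ce + ep * lpow x ^+ 2.
    case/andP: uv => uv0 uv1; rewrite ger0_norm; last first.
      apply: addr_ge0; [exact: mulr_ge0 b0 uv0|exact: divr_ge0 dp0 (ltW vx)].
    rewrite /Ce -addrA; apply: lerD; first by rewrite ler_piMr.
    by rewrite addrC; exact: lo.
  have h3 : lambda * (n%:R * r * y) <= n%:R * lambda * r * T.
    have -> : lambda * (n%:R * r * y) = n%:R * lambda * r * y by ring.
    rewrite ler_wpM2l ?mulr_ge0 ?(ltW l0) // /T lerDl; exact: ltW.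
  have h4 : Ce <= Ce * r * T.
    rewrite -mulrA ler_peMr // mulr_ege1 // /T; apply: le_trans zx1 _; by rewrite lerDr.
  have -> : L0 * r * T = n%:R * lambda * r * T + Ce * r * T by rewrite /L0; ring.
  by apply: le_trans (lerD h1 h2) _; rewrite addrA lerD2r lerD.
have ep01 : 0 <= ep <= 1 by rewrite (ltW ep_gt0) /ep ge_min lexx.
have epc : 16 * (ep * (kk + 1)) <= c.
  have h : 0 < 16 * (kk + 1) by have := kk0; lra.
  have -> : 16 * (ep * (kk + 1)) = ep * (16 * (kk + 1)) by ring.
  by rewrite -ler_pdivlMr // /ep ge_min lexx orbT.
have L0r : 0 <= L0 * r by rewrite mulr_ge0.
have N01 : 0 <= (1 - n%:R^-1 : R) <= 1.
  rewrite subr_ge0 gerBl invr_ge0 ler0n andbT invf_le1; by have := n_ge2; lra.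
have sig := scaled_combination_le c0 ce1 hA (erefl k3) N01 hB y0 zx1 (erefl T) phi0 phipsi bhK DK ehK
  L0r ep01 K0 (lexx kk) epc.
have Sle : gs_form r x <= lifted x ^+ 2 / lpow x * (- (c / 16) * cutoff r x ^+ m.+4 * T ^+ 4 + C0 * r ^+ 2 * cutoff r x ^+ m.+2 * T ^+ 3).
  rewrite /gs_form gs_combinationE; last exact: hess_sym.
  rewrite powNhexp powNhexpB1 powNhexpB2 pow1Dhexp (_ : powv lifted hexp x = lpow x) // gE.
  rewrite -/L -/b -/D.
  have LE : L = lifted x * l by rewrite /l mulrCA divff // mulr1.
  have bE : b = lifted x * bh by rewrite /bh mulrCA divff // mulr1.
  rewrite LE bE.
  have nR0 : 0 < n%:R :> R by rewrite ltr0n (leq_trans _ hn).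
  have tr := @sqr_trace_le _ _ (fun i => dpart i x) (fun i j => hess i j x) (A0 / lifted x).
  rewrite /= -/L LE -/(gradsq dpart x) gE in tr.
  pose Hvv := \sum_(i < n) \sum_(j < n) dpart i x * dpart j x * hess i j x.
  pose HH := \sum_(i < n) \sum_(j < n) hess i j x * hess i j x.
  pose Hvf := \sum_(i < n) \sum_(j < n) dpart i x * cutoff1 r m j x * hess i j x.
  apply: (le_trans (@gs_combination_le R n%:R (lifted x) (lpow x) y l bh (cutoff r x ^+ m.+4) A0 hexp k3 Hvv Hvf HH D nR0 vx zx phi0 tr)).
  apply: ler_wpM2l; first by rewrite divr_ge0 ?sqr_ge0 // ltW.
  have lE : l = - lpow x ^+ 2 + eh by rewrite /eh; ring.
  rewrite lE; apply: le_trans sig _; rewrite lerD2l.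
  apply: ler_wpM2r; first by rewrite exprn_ge0 // addr_ge0 // ltW.
  apply: ler_wpM2r => //.
  have -> : L0 * r * (kk + 2 + L0 * r) + K * (kk + 2 + L0 * r) = (L0 * r + K) * (kk + 2 + L0 * r) by ring.
  have kk2 : 0 <= kk + 2 by apply: addr_ge0 => //; exact: kk0.
  have h1 : L0 * r + K <= (L0 + K) * r by rewrite (mulrDl L0) lerD2l ler_peMr.
  have h2 : kk + 2 + L0 * r <= (kk + 2 + L0) * r.
    by rewrite (mulrDl (kk + 2)) lerD2r ler_peMr.
  have -> : C0 * r ^+ 2 = (L0 + K) * r * ((kk + 2 + L0) * r) by rewrite /C0; ring.
  by apply: ler_pM => //; [exact: addr_ge0 L0r K0|exact: addr_ge0 kk2 L0r].
apply: le_trans Sle _; rewrite /energy gE.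
have vT : lifted x <= T ^+ k0.
  apply: (@le_trans _ _ (lpow x ^+ k0)).
    rewrite /lpow -powR_mulrn ?powR_ge0 // -powRrM -{1}[lifted x]powRr1 ?(ltW vx) //.
    by rewrite ler_powR.
  by apply: lerXn2r; rewrite ?nnegrE ?(ltW zx) // /T ?lerDr // addr_ge0 // ltW.
have := @absorb_cubic_term R (lifted x) (lpow x) y T (cutoff r x) c (C0 * r ^+ 2) m.+4 k0 c0 _
   (cutoff_ge0 r x) (cutoff_le1 r x) vx1 zx1 y0 erefl vT _.
apply.
  by rewrite mulr_ge0 // sqr_ge0.
by rewrite /m mulnDr mulnA; exact: leqnn.
Qed.

(** The integral of [gs_form] is 0, so the pointwise bound integrates to a bound
    for the energy by the volume of the box. *)
Lemma local_estimate_explicit r : 1 <= r ->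
  intR (fun x : 'rV[R]_n => cutoff r x ^+ m.+4 * energy x) <=
   32 / c * ((C0 * r ^+ 2) * (32 * (C0 * r ^+ 2) / c) ^+ (3 + 2 * k0) * (2 * r) ^+ n).
Proof.
move=> r1; have r0 : 0 < r by exact: lt_le_trans ltr01 r1.
have ccp : test_fun (fun x : 'rV[R]_n => cutoff r x ^+ m.+4) by exact: (@test_fun_cutoff _ _ r m.+3 r0).
have [ccS S0] : null_integral (gs_form r).
  apply: null_integral_gs; [exact: lifted_gt0|exact: cont_lifted|exact: cont_dpart|exact: cont_hess|exact: ccp|
    exact: cont_cutoff1|exact: cont_cutoff2|exact: Dlifted|exact: Ddpart| |exact: is_derive_cutoff1].
  by move=> i x; exact: is_derive_cutoffX.
have ccG : test_fun (fun x => cutoff r x ^+ m.+4 * energy x) by apply: test_funM => //; exact: cont_energy.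
have := @intR_le_box R n (fun x => c / 32 * (cutoff r x ^+ m.+4 * energy x) + gs_form r x) r
  ((C0 * r ^+ 2) * (32 * (C0 * r ^+ 2) / c) ^+ (3 + 2 * k0)) (ltW r0).
have M0 : 0 <= (C0 * r ^+ 2) * (32 * (C0 * r ^+ 2) / c) ^+ (3 + 2 * k0).
  have h : 0 <= C0 * r ^+ 2 := mulr_ge0 C00 (sqr_ge0 r).
  apply: mulr_ge0 => //; apply: exprn_ge0; apply: divr_ge0; last exact: ltW.
  exact: mulr_ge0.
have out x : r ^+ 2 <= dot x x -> c / 32 * (cutoff r x ^+ m.+4 * energy x) + gs_form r x = 0.
  by move=> h; rewrite gs_form_outside // cutoff_eq0 // expr0n /= mul0r mulr0 addr0.
move=> /(_ M0 (test_funD (test_funZ (c / 32) ccG) ccS)); rewrite intRD //; last exact: test_funZ.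
rewrite intRZ // S0 addr0 => H1.
have {}H1 : c / 32 * intR (fun x : 'rV[R]_n => cutoff r x ^+ m.+4 * energy x) <=
    (C0 * r ^+ 2) * (32 * (C0 * r ^+ 2) / c) ^+ (3 + 2 * k0) * (2 * r) ^+ n.
  apply: H1 => x.
    have [h|/ltW h] := leP (dot x x) (r ^+ 2); last by rewrite out.
    by have := gs_form_inside r1 h; rewrite mulNr [leRHS]addrC lerBrDr addrC.
  by move=> rx; rewrite out // lt_norm_le_dot // ltW.
have cn : c != 0 by exact: lt0r_neq0.
rewrite [leLHS](_ : _ = 32 / c * (c / 32 * intR (fun x => cutoff r x ^+ m.+4 * energy x))); last first.
  by field.
by apply: ler_wpM2l => //; rewrite divr_ge0 // ltW.
Qed.

End local_bound.
End solution.

Lemma local_estimate (R : realType) (n : nat) (p lambda beta : R) (u : 'rV[R]_n -> R) :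
  (2 <= n)%N -> 1 < p -> (n%:R - 2) * p < n%:R + 2 -> 0 < lambda -> 0 <= beta ->
  (forall x, 0 <= u x) -> classical_solution lambda beta p u ->
  exists (m N : nat) (C : R), 0 <= C /\ forall r, 1 <= r ->
    intR (fun x => cutoff r x ^+ m.+1 * energy p u x) <= C * r ^+ N.
Proof.
move=> hn p1 hp l0 b0 u0 hu.
have n2 : 2 <= n%:R :> R by rewrite ler_nat.
have [A0 [e1 [c [c0 ce1 hA hB]]]] := gs_constants n2 p1 hp.
(* [k0] >= 1 / s, so that v = z^(1/s) <= T^k0. *)
pose k0 := Num.bound ((hexp p)^-1).
have s0 := hexp_gt0 p1.
have hk0 : 1 <= hexp p * k0%:R.
  rewrite mulrC -ler_pdivrMr // div1r; apply: ltW.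
  by apply: archi_boundP; rewrite invr_ge0 ltW.
pose M := (3 + 2 * k0)%N.
have [X HX] : exists X : R, forall r, 1 <= r ->
    intR (fun x => cutoff r x ^+ (4 + 4 * k0).+4 * energy p u x) <=
     32 / c * ((X * r ^+ 2) * (32 * (X * r ^+ 2) / c) ^+ M * (2 * r) ^+ n).
  eexists => r r1; exact: (local_estimate_explicit hn p1 l0 b0 u0 hu c0 ce1 hA hB hk0 r1).
pose C := 32 / c * (X * (32 * X / c) ^+ M * 2 ^+ n).
(* m = 8 + 4 k0 = 2 + 2 (3 + 2 k0), the least exponent that absorption allows. *)
exists (4 + 4 * k0).+3, (2 + 2 * M + n)%N, `|C|; split => // r r1.
apply: le_trans (HX r r1) _.
have -> : 32 / c * (X * r ^+ 2 * (32 * (X * r ^+ 2) / c) ^+ M * (2 * r) ^+ n) = C * r ^+ (2 + 2 * M + n).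
  have -> : 32 * (X * r ^+ 2) / c = (32 * X / c) * r ^+ 2 by ring.
  rewrite (exprMn M (32 * X / c)) (exprMn n 2 r) -(exprM r 2 M) 2!exprD /C.
  move: ((32 * X / c) ^+ M) (r ^+ (2 * M)) (r ^+ n) (2 ^+ n) => t1 t2 t3 t4; ring.
by rewrite ler_wpM2r ?exprn_ge0 ?ler_norm // (le_trans ler01).
Qed.

(** * From polynomial growth to Gaussian weights *)

(** [k] is the least exponent with d <= 4^k: then d > 4^(k-1), and the exponential
    exceeds any power of 2^k. *)
Lemma gaussian_decay (R : realType) (g : R) (j : nat) : 0 < g -> (0 < j)%N ->
  exists2 E : R, 0 <= E & forall d, 0 <= d -> exists k : nat,
    d <= 4 ^+ k /\ expR (- (g * d)) <= E / 2 ^+ (j * k).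
Proof.
move=> g0 j0; have jR : 0 < j%:R :> R by rewrite ltr0n.
pose Q := (2 * (j%:R / g)) ^+ j.
have Q0 : 0 <= Q by rewrite exprn_ge0 // mulr_ge0 // divr_ge0 // ltW.
exists (1 + Q) => [|d d0]; first by rewrite addr_ge0.
have ex : exists k, d <= 4 ^+ k.
  exists (Num.bound d); apply: (@le_trans _ _ (2 ^+ Num.bound d)).
    exact/ltW/upper_nthrootP.
  by apply: lerXn2r; rewrite ?nnegrE // ler_nat.
case: (ex_minnP ex) => -[|k] dk mink; [exists 0%N|exists k.+1]; split => //.
  rewrite muln0 expr0 divr1; apply: (@le_trans _ _ 1); last by rewrite lerDl.
  by rewrite -expR0 ler_expR oppr_le0 mulr_ge0 // ltW.
have kd : 4 ^+ k <= d.
  by rewrite leNgt; apply/negP => /ltW /mink; rewrite ltnn.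
apply: (@le_trans _ _ (expR (- (g * 4 ^+ k)))).
  by rewrite ler_expR lerN2 ler_wpM2l // ltW.
rewrite expRN -div1r ler_pdivrMr ?expR_gt0 // mulrAC ler_pdivlMr ?exprn_gt0 // mul1r.
have h1 : (g * 4 ^+ k / j%:R) ^+ j <= expR (g * 4 ^+ k).
  have -> : g * 4 ^+ k = j%:R * (g * 4 ^+ k / j%:R).
    by rewrite [RHS]mulrC divfK // gt_eqF.
  rewrite expRM_natl; have -> : j%:R * (g * 4 ^+ k / j%:R) / j%:R = g * 4 ^+ k / j%:R.
    by rewrite [j%:R * _]mulrC divfK // gt_eqF.
  apply: lerXn2r; rewrite ?nnegrE ?expR_ge0 //.
    by rewrite divr_ge0 // mulr_ge0 ?exprn_ge0 // ltW.
  by apply: le_trans (expR_ge1Dx _); rewrite lerDr.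
apply: (@le_trans _ _ (Q * (g * 4 ^+ k / j%:R) ^+ j)); last first.
  apply: ler_pM => //; last by rewrite lerDr.
  by rewrite exprn_ge0 // divr_ge0 // mulr_ge0 ?exprn_ge0 // ltW.
rewrite /Q -exprMn mulnC exprM.
have -> : 2 * (j%:R / g) * (g * 4 ^+ k / j%:R) = 2 * 4 ^+ k :> R.
  by field; rewrite !gt_eqF.
apply: lerXn2r; rewrite ?nnegrE ?exprn_ge0 ?mulr_ge0 ?exprn_ge0 //.
rewrite exprS ler_wpM2l //; apply: lerXn2r; rewrite ?nnegrE // ler_nat //.
Qed.

(** The cutoff of radius 2^(k+1) is at least 3 / 4 where dot x x <= 4^k, so the
    weighted function is below a series over k of cut off functions, with
    coefficients that decay faster than the integrals grow. *)
Lemma gaussian_integrable (R : realType) (n : nat) (G : 'rV[R]_n -> R) (m N : nat) (C g : R) :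
  continuous G -> (forall x, 0 <= G x) -> 0 <= C ->
  (forall r, 1 <= r -> intR (fun x => cutoff r x ^+ m.+1 * G x) <= C * r ^+ N) ->
  0 < g ->
  (integral_Rn (fun x => (G x * expR (- (g * dot x x)))%R) < +oo)%E.
Proof.
move=> cG G0 C0 HC g0.
have [E E0 HE] := @gaussian_decay R g N.+1 g0 isT.
pose r k : R := 2 ^+ k.+1.
have r1 k : 1 <= r k by rewrite exprn_ege1 // ler1n.
have r0 k : 0 < r k by exact: lt_le_trans ltr01 (r1 k).
pose h k x := E / 2 ^+ (N.+1 * k) * (4 / 3) ^+ m.+1 * (cutoff (r k) x ^+ m.+1 * G x).
have h0 k x : 0 <= h k x.
  by rewrite /h !mulr_ge0 ?invr_ge0 ?exprn_ge0 ?divr_ge0 ?cutoff_ge0.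
have ccg k : test_fun (fun x => cutoff (r k) x ^+ m.+1 * G x).
  by apply: test_funM => //; apply: test_fun_cutoff.
have cch k : test_fun (h k) by exact: test_funZ.
have cg : continuous (fun x : 'rV[R]_n => G x * expR (- (g * dot x x))).
  apply: contM => //.
  apply: (@cont_comp1 _ _ expR (fun x => - (g * dot x x))).
    exact: (contN (contM (@contC _ _ g) cont_dot)).
  by move=> x; exact: continuous_expR.
have mh k : measurable_fun setT (fun t => (h k (rV_of_tuple t))%:E).
  by apply/measurable_EFinP; apply: measurable_rV; case: (cch k).
rewrite /integral_Rn.
apply: (@le_lt_trans _ _ (\int[@lebesgue_tuple R n]_t \sum_(0 <= k <oo) (h k (rV_of_tuple t))%:E)%E).
  apply: ge0_le_integral => //.
  - by move=> t _; rewrite lee_fin mulr_ge0 // expR_ge0.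
  - by apply/measurable_EFinP; exact: (measurable_rV cg).
  - apply: (@ge0_emeasurable_sum _ _ _ _ (fun k t => (h k (rV_of_tuple t))%:E) xpredT) => //.
    by move=> k t _ _; rewrite lee_fin.
  move=> t _; set x := rV_of_tuple t.
  have [k [dk Ek]] := HE _ (dot_ge0 x).
  apply: (@le_trans _ _ (\sum_(0 <= i < k.+1) (h i x)%:E)%E); last first.
    by apply: nneseries_lim_ge => i _ _; rewrite lee_fin.
  rewrite big_nat_recr //=; apply: (@le_trans _ _ (h k x)%:E); last first.
    by rewrite leeDr // sume_ge0 // => i _; rewrite lee_fin.
  rewrite lee_fin /h.
  have ck : 3 / 4 <= cutoff (r k) x.
    rewrite /cutoff le_max; apply/orP; right.
    have : dot x x / r k ^+ 2 <= 1 / 4.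
      rewrite ler_pdivrMr ?exprn_gt0 // /r -exprM mulnC exprM.
      have -> : (2 : R) ^+ 2 = 4 by ring.
      by rewrite exprS mulrA div1r mulVf ?mul1r.
    by lra.
  have q : 1 <= (4 / 3) ^+ m.+1 * cutoff (r k) x ^+ m.+1.
    by rewrite -exprMn exprn_ege1 //; lra.
  have -> : E / 2 ^+ (N.+1 * k) * (4 / 3) ^+ m.+1 * (cutoff (r k) x ^+ m.+1 * G x) =
     ((4 / 3) ^+ m.+1 * cutoff (r k) x ^+ m.+1) * (E / 2 ^+ (N.+1 * k) * G x) by ring.
  rewrite mulrC; apply: (@le_trans _ _ (E / 2 ^+ (N.+1 * k) * G x)).
    by rewrite ler_wpM2r.
  by rewrite ler_peMl // mulr_ge0 // divr_ge0 // exprn_ge0.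
rewrite integral_nneseries //; last by move=> k t _; rewrite lee_fin.
(* The k-th integral is at most D / 2^(k+1). *)
pose D := 2 * (E * (4 / 3) ^+ m.+1 * C * 2 ^+ N).
have D0 : 0 <= D by rewrite /D !mulr_ge0 ?exprn_ge0 ?divr_ge0.
apply: (@le_lt_trans _ _ D%:E); last exact: ltry.
apply: le_trans (epsilon_trick0 xpredT D0).
apply: lee_nneseries => k *.
  by apply: integral_ge0 => t _; rewrite lee_fin.
have -> : (\int[@lebesgue_tuple R n]_t (h k (rV_of_tuple t))%:E)%E = (intR (h k))%:E.
  rewrite /intR /Rintegral fineK //; apply: integrable_fin_num => //.
  exact: test_fun_integrable (cch k).
rewrite lee_fin /h intRZ //.
have a0 : 0 <= E / 2 ^+ (N.+1 * k) * (4 / 3) ^+ m.+1.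
  by rewrite !mulr_ge0 ?invr_ge0 ?exprn_ge0 ?divr_ge0.
apply: le_trans (ler_wpM2l a0 (HC _ (r1 k))) _.
rewrite le_eqVlt; apply/orP; left; apply/eqP.
rewrite /D /r natrX mulSn exprD -!exprM mulSn exprD [(k * N)%N]mulnC (exprS 2 k).
have p1 : (2 : R) ^+ k != 0 by rewrite expf_neq0.
have p2 : (2 : R) ^+ (N * k) != 0 by rewrite expf_neq0.
move: p1 p2; move: ((2 : R) ^+ k) ((2 : R) ^+ (N * k)) (2 ^+ N) ((4 / 3) ^+ m.+1) => t1 t2 t3 t4 p1 p2.
by field; rewrite p1 p2.
Qed.

Unset Implicit Arguments.

Theorem lemma2p1 (R : realType) (n : nat) (hn : (2 <= n)%N)
    (p : R) (hp1 : 1 < p) (hp : (p%:E < p_star R n)%E)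
    (lambda beta : R) (hlambda : 0 < lambda) (hbeta : 0 <= beta)
    (u : 'rV[R]_n -> R) (u_ge0 : forall x, 0 <= u x)
    (hu : classical_solution lambda beta p u)
    (gamma : R) (hgamma : 0 < gamma) :
  (integral_Rn (fun x : 'rV[R]_n =>
     (u x `^ (p + 1) * expR (- (gamma * dot x x)) +
     dot (grad u x) (grad u x) * expR (- (gamma * dot x x)))%R) < +oo)%E.
Proof.
have sub := subcritical hn hp.
have [m [N [C [C0 HC]]]] := local_estimate hn hp1 sub hlambda hbeta u_ge0 hu.
have cu : continuous u by case: hu => -[].
have cG : continuous (energy p u) by exact: (cont_energy u_ge0 hu).
have gE x : dot (grad u x) (grad u x) = gradsq (dpart u) x.
  by apply: eq_bigr => i _; rewrite /grad mxE.
have G0 x : 0 <= energy p u x by rewrite addr_ge0 ?sqr_ge0 // gradsq_ge0.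
have cexp : continuous (fun x : 'rV[R]_n => expR (- (gamma * dot x x))).
  apply: (@cont_comp1 _ _ expR (fun x => - (gamma * dot x x))).
    exact: (contN (contM (@contC _ _ gamma) cont_dot)).
  by move=> x; exact: continuous_expR.
have cg := cont_gradsq (cont_dpart hu).
apply: le_lt_trans (gaussian_integrable cG G0 C0 HC hgamma).
have E x : u x `^ (p + 1) * expR (- (gamma * dot x x)) +
    dot (grad u x) (grad u x) * expR (- (gamma * dot x x)) =
    (u x `^ (p + 1) + gradsq (dpart u) x) * expR (- (gamma * dot x x)).
  by rewrite gE mulrDl.
apply: ge0_le_integral => //.
- by move=> t _; rewrite E lee_fin mulr_ge0 ?expR_ge0 // addr_ge0 ?powR_ge0 ?gradsq_ge0.
- under eq_fun do rewrite E.
  apply/measurable_EFinP; apply: measurable_funM; last exact: (measurable_rV cexp).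
  apply: measurable_funD; last exact: (measurable_rV cg).
  by apply: (measurableT_comp (measurable_powR (p + 1))); exact: (measurable_rV cu).
- by apply/measurable_EFinP; exact: (measurable_rV (contM cG cexp)).
move=> t _; rewrite E lee_fin; apply: ler_wpM2r; first exact: expR_ge0.
rewrite /energy lerD2r; set x := rV_of_tuple t.
have -> : (lifted u x * lpow p u x) ^+ 2 = lifted u x `^ (p + 1).
  have v0 := lifted_gt0 u_ge0 x.
  rewrite powRD; last by rewrite (gt_eqF v0) implybT.
  by rewrite powRr1 ?(ltW v0) // (lifted_powR hp1 u_ge0); ring.
by apply: ge0_ler_powR; rewrite ?nnegrE ?lerDl // ?addr_ge0 // ltW // (lt_trans ltr01 hp1).
Qed.
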